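(* For every $n\ge 3$, let $$u_n:=a_n,\qquad v_n:=b_n^{-1}T_{1,2}.$$ Then $u_n$ has order $n$ if $n$ is odd and order $2n$ if $n$ is even, while $v_n$ has order $6$. Moreover, $\mathrm{SL}_n(\mathbb Z)$ admits a finite presentation on generators $u,v$ corresponding to the pair $(u_n,v_n)$: $$\mathrm{SL}_n(\mathbb Z)\cong\left\langle u,v\,\middle|\,\mathcal R_n\bigl(u,W(u,v)\bigr),\ v=W(u,v)^{-1}\tau_{1,2}\bigl(u,W(u,v)\bigr)\right\rangle,$$ where $W(u,v):=(uvu^{-1})v^{-1}(uv^{-1}u^{-1})v^{-1}(uvu^{-1})v$ and $\mathcal R_n(u,W(u,v))$ is obtained from $\mathcal R_n(a,b)$ by substituting $a=u$, $b=W(u,v)$.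
   Context: $E_{i,j}$ is the standard $n\times n$ matrix unit, $T_{i,j}=I_n+E_{i,j}$ ($i\ne j$), $[x,y]=x^{-1}y^{-1}xy$, and a relation $U=V$ means the relator $UV^{-1}$. Put $\varepsilon_n=(-1)^{n-1}$ and $$a_n=\sum_{i=1}^{n-1}E_{i,i+1}+\varepsilon_nE_{n,1},\qquad b_n=I_n+E_{2,1}.$$ The words $\tau_{ij}=\tau_{i,j}=\tau_{ij}(a,b)$ in the free group on $a,b$ ($1\le i\ne j\le n$) are defined as follows. Step 1: $\tau_{r+1,r}:=a^{-(r-1)}ba^{r-1}$ for $1\le r\le n-1$, and $\tau_{1n}:=\bigl(a^{-(n-1)}ba^{n-1}\bigr)^{\varepsilon_n}$. Step 2: for $d=2,\dots,n-1$ successively and all $i,j$ with $i-j=d$, $\tau_{ij}:=[\tau_{i,j+1},\tau_{j+1,j}]$. Step 3: for $2\le i\le n-1$, $\tau_{in}:=[\tau_{i1},\tau_{1n}]$. Step 4: for $1\le i<j\le n-1$, $\tau_{ij}:=[\tau_{in},\tau_{nj}]$. $\mathcal R_n(a,b)$ denotes the following set of relations (indices in $\{1,\dots,n\}$): (1) $[\tau_{i,j},\tau_{k,l}]=1$ for all $i\neq j$, $k\ne l$ with $(i,j)\ne(k,l)$, $i\ne l$, $j\ne k$; (2) $[\tau_{i,j},\tau_{j,k}]=\tau_{i,k}$ for distinct $i,j,k$; (3) $(\tau_{1,2}\tau_{2,1}^{-1}\tau_{1,2})^4=1$; (4) $a=(\tau_{n-1,n}\tau_{n,n-1}^{-1}\tau_{n-1,n})(\tau_{n-2,n-1}\tau_{n-1,n-2}^{-1}\tau_{n-2,n-1})\cdots(\tau_{1,2}\tau_{2,1}^{-1}\tau_{1,2})$.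 *)

(* Defs.v *)
From HB Require Import structures.
From mathcomp Require Import all_boot all_order all_algebra.
From mathcomp Require Import boolp.

Set Implicit Arguments.
Unset Strict Implicit.
Unset Printing Implicit Defensive.

Import GRing.Theory.

Local Open Scope group_scope.

(* Elements are reduced words in the letters (x, true) = x and
   (x, false) = x^-1. *)
Section FreeGroup.
Variable X : choiceType.

Definition letter : Type := X * bool.
HB.instance Definition _ := Choice.on letter.

Implicit Types (l : letter) (w : seq letter).

Definition letter_inv l : letter := (l.1, ~~ l.2).

Definition reduced w := sorted (fun l l' => l' != letter_inv l) w.

Definition push l w :=
  if w is l' :: w' then if l' == letter_inv l then w' else l :: w
  else [:: l].

Definition reduce w := foldr push [::] w.

Definition word_inv w := rev (map letter_inv w).

Lemma letter_invK : involutive letter_inv.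
Proof. by case=> x b; rewrite /letter_inv /= negbK. Qed.

Lemma reduced_behead l w : reduced (l :: w) -> reduced w.
Proof. by rewrite /reduced; case: w => //= l' w /andP[]. Qed.

Lemma reduced_push l w : reduced w -> reduced (push l w).
Proof.
case: w => //= l' w rw; case: ifPn => [_|nl]; first exact: reduced_behead rw.
by rewrite /reduced /= nl.
Qed.

Lemma foldr_push_reduced w1 w2 : reduced w2 -> reduced (foldr push w2 w1).
Proof. by move=> r2; elim: w1 => //= l w1; apply: reduced_push. Qed.

Lemma reduce_reduced w : reduced (reduce w).
Proof. exact: foldr_push_reduced. Qed.

Lemma reduce_id w : reduced w -> reduce w = w.
Proof.
elim: w => //= l w IHw rlw; rewrite IHw ?(reduced_behead rlw) //.
case: w rlw {IHw} => //= l' w; rewrite /reduced /= => /andP[nl _].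
by rewrite (negPf nl).
Qed.

Lemma pushK l w : reduced w -> push l (push (letter_inv l) w) = w.
Proof.
case: w => [|l' w] /=; first by rewrite eqxx.
rewrite letter_invK; case: eqP => [->|_] rw /=; last by rewrite eqxx.
case: w rw => //= l'' w; rewrite /reduced /= => /andP[nl _].
by rewrite (negPf nl).
Qed.

Lemma foldr_push_reduce w1 w2 :
  reduced w2 -> foldr push w2 (reduce w1) = foldr push w2 w1.
Proof.
move=> r2; elim: w1 => //= l w1; rewrite -/(reduce w1) => <-.
have := reduce_reduced w1; case: (reduce w1) => //= l' w rw.
case: eqP => [->|//]; rewrite pushK //; exact: foldr_push_reduced.
Qed.

Lemma reduce_cat w1 w2 : reduce (w1 ++ w2) = foldr push (reduce w2) w1.
Proof. exact: foldr_cat. Qed.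

Lemma foldr_push_invl w1 w2 :
  reduced w2 -> foldr push (foldr push w2 w1) (word_inv w1) = w2.
Proof.
move=> r2; elim: w1 => //= l w1 IHw.
rewrite /word_inv /= rev_cons -cats1 foldr_cat /= -{2}[l]letter_invK.
by rewrite pushK ?IHw //; apply: foldr_push_reduced.
Qed.

Record free_group := FreeGroup { fg_word :> seq letter; _ : reduced fg_word }.
HB.instance Definition _ := [isSub for fg_word].
HB.instance Definition _ := [Choice of free_group by <:].

Definition fg_of w : free_group := FreeGroup (reduce_reduced w).
Definition fg_gen (x : X) : free_group := fg_of [:: (x, true)].
Definition fg_one : free_group := fg_of [::].
Definition fg_mul (g h : free_group) : free_group := fg_of (g ++ h).
Definition fg_inv (g : free_group) : free_group := fg_of (word_inv g).

Lemma fg_reduceK (g : free_group) : reduce g = g.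
Proof. by apply: reduce_id; case: g. Qed.

Lemma fg_mulA : associative fg_mul.
Proof.
move=> g h k; apply: val_inj => /=.
rewrite (reduce_cat (reduce _)) foldr_push_reduce; last exact: reduce_reduced.
by rewrite -!reduce_cat -catA reduce_cat reduce_id ?reduce_cat //;
   apply: foldr_push_reduced; apply: reduce_reduced.
Qed.

Lemma fg_mul1 : left_id fg_one fg_mul.
Proof. by move=> g; apply: val_inj; rewrite /= fg_reduceK. Qed.

Lemma fg_mulr1 : right_id fg_one fg_mul.
Proof. by move=> g; apply: val_inj; rewrite /= cats0 fg_reduceK. Qed.

Lemma fg_mulV : left_inverse fg_one fg_inv fg_mul.
Proof.
move=> g; apply: val_inj => /=; rewrite reduce_cat fg_reduceK.
rewrite foldr_push_reduce; last by case: g.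
by rewrite -{1}[fg_word g]fg_reduceK foldr_push_invl.
Qed.

Lemma word_invK : involutive word_inv.
Proof.
by move=> w; rewrite /word_inv map_rev revK -map_comp map_id_in // => l _;
   apply: letter_invK.
Qed.

Lemma fg_mulVr : right_inverse fg_one fg_inv fg_mul.
Proof.
move=> g; apply: val_inj => /=; rewrite reduce_cat.
rewrite reduce_id; last exact: reduce_reduced.
have := @foldr_push_invl (word_inv g) [::] isT.
by rewrite word_invK.
Qed.

HB.instance Definition _ := isGroup.Build free_group
  fg_mulA fg_mul1 fg_mulr1 fg_mulV fg_mulVr.

End FreeGroup.

Inductive normal_closure (G : groupType) (R : seq G) : G -> Prop :=
| ncl_rel r of r \in R : normal_closure R r
| ncl_one : normal_closure R 1
| ncl_mul g h of normal_closure R g & normal_closure R h :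
    normal_closure R (g * h)
| ncl_inv g of normal_closure R g : normal_closure R g^-1
| ncl_conj g h of normal_closure R g : normal_closure R (g ^ h).

Section Presented.
Variables (X : choiceType) (R : seq (free_group X)).
Implicit Types g h : free_group X.

Definition ncl_rel_eq g h : bool := `[< normal_closure R (g^-1 * h) >].

Lemma ncl_rel_eq_refl : reflexive ncl_rel_eq.
Proof. by move=> g; apply/asboolP; rewrite mulVg; apply: ncl_one. Qed.

Lemma ncl_rel_eq_sym : symmetric ncl_rel_eq.
Proof.
suff H g h : ncl_rel_eq g h -> ncl_rel_eq h g by move=> g h; apply/idP/idP; apply: H.
by move=> /asboolP /ncl_inv; rewrite invgM invgK => ?; apply/asboolP.
Qed.

Lemma ncl_rel_eq_trans : transitive ncl_rel_eq.
Proof.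
move=> h g k /asboolP gh /asboolP hk; apply/asboolP.
by have := ncl_mul gh hk; rewrite !mulgA mulgK.
Qed.

Canonical ncl_equiv :=
  EquivRel ncl_rel_eq ncl_rel_eq_refl ncl_rel_eq_sym ncl_rel_eq_trans.

Definition presented : Type := {eq_quot ncl_equiv}%qT.
HB.instance Definition _ := Choice.on presented.
HB.instance Definition _ := EqQuotient.on presented.

Definition pres_pi (g : free_group X) : presented := (\pi_presented g)%qT.
Definition pres_gen (x : X) : presented := pres_pi (fg_gen x).

Definition pres_one : presented := pres_pi 1.
Definition pres_mul (x y : presented) : presented := pres_pi (repr x * repr y).
Definition pres_inv (x : presented) : presented := pres_pi (repr x)^-1.

Lemma pres_piP g h : pres_pi g = pres_pi h <-> normal_closure R (g^-1 * h).
Proof. by split=> [/eqquotP/asboolP|?]; last by apply/eqquotP/asboolP. Qed.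

Lemma pres_reprP g : normal_closure R (g^-1 * repr (pres_pi g)).
Proof. by apply/pres_piP; rewrite /pres_pi reprK. Qed.

Lemma pres_mulE g h : pres_mul (pres_pi g) (pres_pi h) = pres_pi (g * h).
Proof.
apply/esym/pres_piP; have ng := pres_reprP g; have nh := pres_reprP h.
have := ncl_mul (ncl_conj h ng) nh.
by rewrite conjgE invgM !mulgA mulgK.
Qed.

Lemma pres_invE g : pres_inv (pres_pi g) = pres_pi g^-1.
Proof.
apply/pres_piP; have := ncl_conj g^-1 (pres_reprP g).
by rewrite conjgE invgK !invgK !mulgA mulgV mul1g.
Qed.

Lemma presE (x : presented) : x = pres_pi (repr x).
Proof. by rewrite /pres_pi reprK. Qed.

Lemma pres_mulA : associative pres_mul.
Proof.
by move=> x y z; rewrite (presE x) (presE y) (presE z) !pres_mulE mulgA.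
Qed.

Lemma pres_mul1 : left_id pres_one pres_mul.
Proof. by move=> x; rewrite (presE x) pres_mulE mul1g. Qed.

Lemma pres_mulr1 : right_id pres_one pres_mul.
Proof. by move=> x; rewrite (presE x) pres_mulE mulg1. Qed.

Lemma pres_mulV : left_inverse pres_one pres_inv pres_mul.
Proof. by move=> x; rewrite (presE x) pres_invE pres_mulE mulVg. Qed.

Lemma pres_mulVr : right_inverse pres_one pres_inv pres_mul.
Proof. by move=> x; rewrite (presE x) pres_invE pres_mulE mulgV. Qed.

HB.instance Definition _ := isGroup.Build presented
  pres_mulA pres_mul1 pres_mulr1 pres_mulV pres_mulVr.

End Presented.

Definition has_order (G : groupType) (x : G) (k : nat) : Prop :=
  [/\ 0 < k, x ^+ k = 1 & forall m, 0 < m < k -> x ^+ m <> 1].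

Section SpecialLinear.
Variable n : nat.

Record SLZ := MkSLZ { sl_mx :> 'M[int]_n; sl_det : (\det sl_mx == 1)%R }.
HB.instance Definition _ := [isSub for sl_mx].
HB.instance Definition _ := [Choice of SLZ by <:].

Lemma SLZ_unit (A : SLZ) : (A : 'M[int]_n) \in unitmx.
Proof. by case: A => A dA; rewrite unitmxE (eqP dA) unitr1. Qed.

Fact sl_one_subproof : (\det (1%:M : 'M[int]_n) == 1)%R.
Proof. by rewrite det1. Qed.

Fact sl_mul_subproof (A B : SLZ) : (\det (A *m B) == 1)%R.
Proof.
by case: A B => A dA [B dB] /=; rewrite det_mulmx (eqP dA) (eqP dB) mulr1.
Qed.

Fact sl_inv_subproof (A : SLZ) : (\det (invmx A) == 1)%R.
Proof. by case: A => A dA /=; rewrite det_inv (eqP dA) invr1. Qed.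

Definition sl_one : SLZ := MkSLZ sl_one_subproof.
Definition sl_mul (A B : SLZ) : SLZ := MkSLZ (sl_mul_subproof A B).
Definition sl_inv (A : SLZ) : SLZ := MkSLZ (sl_inv_subproof A).

Lemma sl_mulA : associative sl_mul.
Proof. by move=> A B C; apply: val_inj; rewrite /= mulmxA. Qed.

Lemma sl_mul1 : left_id sl_one sl_mul.
Proof. by move=> A; apply: val_inj; rewrite /= mul1mx. Qed.

Lemma sl_mulr1 : right_id sl_one sl_mul.
Proof. by move=> A; apply: val_inj; rewrite /= mulmx1. Qed.

Lemma sl_mulV : left_inverse sl_one sl_inv sl_mul.
Proof. by move=> A; apply: val_inj; rewrite /= mulVmx // SLZ_unit. Qed.

Lemma sl_mulVr : right_inverse sl_one sl_inv sl_mul.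
Proof. by move=> A; apply: val_inj; rewrite /= mulmxV // SLZ_unit. Qed.

HB.instance Definition _ := isGroup.Build SLZ
  sl_mulA sl_mul1 sl_mulr1 sl_mulV sl_mulVr.

(* Matrix units are indexed from 1: Eunit i j has its 1 at the (0-based)
   entry (i - 1, j - 1). *)
Definition Eunit (i j : nat) : 'M[int]_n :=
  (\matrix_(r, c) ((r.+1 == i) && (c.+1 == j))%:R)%R.

Definition Tmx (i j : nat) : 'M[int]_n := (1%:M + Eunit i j)%R.

Definition a_mx : 'M[int]_n :=
  (\sum_(1 <= i < n) Eunit i i.+1 + (-1) ^+ n.-1 *: Eunit n 1)%R.

Lemma det_Tmx i j : i != j -> (\det (Tmx i j) == 1)%R.
Proof.
have low k l : l < k -> (\det (Tmx k l) == 1)%R.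
  move=> lk; rewrite det_trig.
    rewrite big1 // => r _; rewrite !mxE eqxx /=.
    rewrite (_ : _ && _ = false) ?addr0 //; apply/negP => /andP[/eqP rk /eqP rl].
    by rewrite -rk -rl ltnn in lk.
  apply/is_trig_mxP => r c rc; rewrite !mxE -val_eqE /= (ltn_eqF rc) add0r.
  rewrite (_ : _ && _ = false) //; apply/negP => /andP[/eqP rk /eqP cl].
  by move: lk; rewrite -rk -cl ltnS => /ltnW; rewrite leqNgt rc.
rewrite neq_ltn => /orP[ij|]; last exact: low.
rewrite -det_tr; have -> : (Tmx i j)^T%R = Tmx j i; last exact: low.
by apply/matrixP => r c; rewrite !mxE eq_sym andbC.
Qed.

Lemma a_mxE r c : a_mx r c =
  ((c == r.+1 :> nat)%:R + (-1) ^+ n.-1 * ((r.+1 == n) && (c == 0 :> nat))%:R)%R.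
Proof.
rewrite !mxE summxE eqSS; congr (_ + _)%R.
have [rn|rn] := leqP n r.+1.
  rewrite big_nat big1 => [|i /andP[_ ltin]]; last first.
    by rewrite mxE eqn_leq leqNgt (leq_trans ltin rn).
  by rewrite eqn_leq [(r < c)%N]leqNgt (leq_trans (ltn_ord c) rn) andbF.
rewrite (bigD1_seq r.+1) ?mem_index_iota ?iota_uniq //=.
rewrite mxE eqxx eqSS /= big1 ?addr0 // => i ir.
by rewrite mxE eq_sym (negPf ir).
Qed.


End SpecialLinear.

Lemma det_a_mx n : (\det (a_mx n) == 1)%R.
Proof.
case: n => [|m]; first by rewrite det_mx00.
rewrite (expand_det_col _ ord0) (bigD1 ord_max) //= big1 => [|r rm]; last first.
  rewrite a_mxE /= eqSS (_ : (r == m :> nat) = false) ?mulr0 ?addr0 ?mul0r //.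
  by apply/negbTE; apply: contraNneq rm => rm; apply/eqP/val_inj.
rewrite addr0 a_mxE /= !eqxx /= add0r mulr1 /cofactor addn0.
have -> : row' ord_max (col' ord0 (a_mx m.+1)) = 1%:M%R.
  apply/matrixP => r c; rewrite 2![in LHS]mxE a_mxE [in RHS]mxE /=.
  have -> : bump m r = r by rewrite /bump leqNgt ltn_ord.
  by rewrite /bump /= add1n eqSS andbF mulr0 addr0 eq_sym.
by rewrite det1 mulr1 -expr2 sqrr_sign.
Qed.

Section Generators.
Variable n : nat.

Definition a_ : SLZ n := MkSLZ (det_a_mx n).
Definition b_ : SLZ n := MkSLZ (det_Tmx n (isT : 2 != 1)%N).
Definition T12 : SLZ n := MkSLZ (det_Tmx n (isT : 1 != 2)%N).

Definition u_ : SLZ n := a_.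
Definition v_ : SLZ n := b_^-1 * T12.

End Generators.

(* Group words in a, b are functions of the values of a and b in an arbitrary
   group, so that substitution is application. Indices range over 1, ..., n.
   The library's commutator is [~ x, y] = x^-1 * y^-1 * x * y. *)
Section Words.
Variables (G : groupType) (n : nat) (a b : G).

Definition b_conj (r : nat) : G := a ^- r.-1 * b * a ^+ r.-1.

(* tau_low d j is tau_{j+d+1, j}. *)
Fixpoint tau_low (d j : nat) : G :=
  if d is d'.+1 then [~ tau_low d' j.+1, b_conj j] else b_conj j.

(* The exponent (-1)^(n-1) is 1 for n odd and -1 for n even. *)
Definition tau_1n : G :=
  if odd n then b_conj n else (b_conj n)^-1.

Definition tau_last (i : nat) : G :=
  if i == 1%N then tau_1n else [~ tau_low (i - 2) 1, tau_1n].

(* The value at i = j is irrelevant. *)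
Definition tau (i j : nat) : G :=
  if j < i then tau_low (i - j).-1 j
  else if j == n then tau_last i
  else [~ tau_last i, tau_low (n - j).-1 j].

Definition sigma (i : nat) : G :=
  tau i i.+1 * (tau i.+1 i)^-1 * tau i i.+1.

Definition idx : seq nat := iota 1 n.

Definition idx_pairs : seq (nat * nat) :=
  [seq p <- [seq (i, j) | i <- idx, j <- idx] | p.1 != p.2].

Definition relators1 : seq G :=
  [seq [~ tau p.1 p.2, tau q.1 q.2] | p <- idx_pairs,
    q <- [seq q <- idx_pairs | [&& p != q, p.1 != q.2 & p.2 != q.1]]].

Definition relators2 : seq G :=
  [seq [~ tau p.1 p.2, tau p.2 k] * (tau p.1 k)^-1 | p <- idx_pairs,
    k <- [seq k <- idx | (k != p.1) && (k != p.2)]].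

Definition relator3 : G := sigma 1 ^+ 4.

Definition relator4 : G := a * (\prod_(i <- rev (iota 1 n.-1)) sigma i)^-1.

Definition relators : seq G :=
  relators1 ++ relators2 ++ [:: relator3; relator4].

End Words.

Definition W (G : groupType) (u v : G) : G :=
  (u * v * u^-1) * v^-1 * (u * v^-1 * u^-1) * v^-1 * (u * v * u^-1) * v.

Definition uv_relators (G : groupType) (n : nat) (u v : G) : seq G :=
  rcons (relators n u (W u v)) (v * ((W u v)^-1 * tau n u (W u v) 1 2)^-1).

(* The free generators u and v are indexed by true and false. *)
Definition fu : free_group bool := fg_gen true.
Definition fv : free_group bool := fg_gen false.

Definition SL_presentation (n : nat) : groupType :=
  presented (uv_relators n fu fv).

(* Main.v *)
Require Import Defs.
From HB Require Import structures.
From mathcomp Require Import all_boot all_order all_algebra.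
From mathcomp Require Import perm generic_quotient zify.

Set Implicit Arguments.
Unset Strict Implicit.
Unset Printing Implicit Defensive.

Import GRing.Theory Order.TTheory Num.Theory.

Local Open Scope group_scope.

(** The map sends u, v to u_n, v_n. Conjugation by a_n shifts both indices of an
elementary matrix by one, with the sign (-1)^(n-1) at the wrap-around, so the
words tau_ij evaluate at (a_n, b_n) to the elementary matrices T_ij ([tau_T]);
with W(u_n, v_n) = b_n ([W_uv]) and the factorization of a_n into signed
transpositions ([a_factorization]) all relators hold in SL_n(Z). Surjectivity
is the Euclidean algorithm ([elementary_all]).

In the presented group the last relator expresses v, and the factorization
relator expresses u, through the elements x_ij = tau_ij(u, W(u, v)). So the
group is generated by the x_ij, which satisfy the Steinberg relations and
w_12^4 = 1, where w_ij = x_ij x_ji^-1 x_ij. Injectivity is thus the theorem that for n >= 3 these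
relations present SL_n(Z), proved here by Silvester's argument, as in Milnor's
book on algebraic K-theory ([steinberg_inj]).

Let L_m be generated by the x_ij with i, j < m, let e = m - 1, and let P be
generated by those x_ij of L_m with j <> e, which fix the basis vector e_e. The
main point is that every g in L_m whose matrix fixes e_e lies in P
([stabilizer]). Consider the l1-norm of the column g e_e. Call g reachable if it
is obtained from a product of elements w_ij by left multiplication with
generators x_ij^(+-1), each of which increases the norm; read backwards, this is
a Euclidean reduction of the column. Silvester's observation is that any two
norm-decreasing generators at a column are joined by a path of generators and
elements w_ij that stays below the norm of that column, and that the loop so
formed is a consequence of the relations ([confluent]). As in Newman's lemma,
induction on the norm shows that the set of reachable cosets g P is closed under
multiplication by generators ([stableS]), hence is everything, and that g P is
determined by the column g e_e ([reach_unique]). At norm 1 this needs that a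
product of elements w_ij fixing e_e lies in P ([weyl_stab]); here, and only
here, the relation w_12^4 = 1 is used.

Finally P is a product of the group generated by the x_ej, j < e, on which the
last row of the matrix is a faithful coordinate, and of L_(m-1); so an element of
the kernel in L_m already lies in L_(m-1), and induction on m finishes the proof
([elem_gens_inj]). *)

(** * Steinberg families and their Weyl elements *)
Section Steinberg.

Variables (I : finType) (G : groupType) (x : I -> I -> G).
Implicit Types (i j k l : I) (a b c : bool).

(** The defining relations of the Steinberg group of the integers, for the
    generators with parameter 1 only: x_ij(t) is the power x_ij^t. *)
Definition steinberg : Prop :=
  (forall i j k l, i != j -> k != l -> i != l -> j != k ->
     commute (x i j) (x k l)) /\
  (forall i j k, i != j -> j != k -> i != k -> [~ x i j, x j k] = x i k).

(** A boolean sign lets one statement cover x_ij and its inverse; signs of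
    commutators multiply by exclusive or. *)
Definition signed i j b : G := if b then (x i j)^-1 else x i j.

(** Its matrix is a signed transposition: it sends e_j to (-1)^b e_i and e_i to
    - (-1)^b e_j. *)
Definition weyl i j b : G := signed i j b * signed j i (~~ b) * signed i j b.

Lemma xsV i j b : (signed i j b)^-1 = signed i j (~~ b).
Proof. by case: b; rewrite /= ?invgK. Qed.

Lemma wtV i j b : (weyl i j b)^-1 = weyl i j (~~ b).
Proof. by rewrite /weyl !invgM !xsV mulgA. Qed.

Hypothesis st : steinberg.
Hypothesis third : forall i j, exists k, (k != i) && (k != j).

Lemma xs_comm i j a k l b : i != j -> k != l -> i != l -> j != k ->
  commute (signed i j a) (signed k l b).
Proof.
move=> ij kl il jk; have cx := st.1 i j k l ij kl il jk.
have cV (g h : G) : commute g h -> commute g^-1 h.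
  by move=> gh; apply: commute_sym; apply: commuteV; apply: commute_sym.
by case: a b => [] [] /=; do ?[apply: cV | apply: commuteV].
Qed.

Lemma xs_conj_comm i j a k l b : i != j -> k != l -> i != l -> j != k ->
  signed i j a ^ signed k l b = signed i j a.
Proof. by move=> *; apply/conjg_fixP/commgP/xs_comm. Qed.

(** As x_ik commutes with x_ij and x_jk, the commutator relation for x_ij and
    x_jk determines those for their inverses. *)
Lemma xs_conj_l i j k a b : i != j -> j != k -> i != k ->
  signed i j a ^ signed j k b = signed i j a * signed i k (a (+) b).
Proof.
move=> ij jk ik; have R := st.2 i j k ij jk ik.
have ki : k != i by rewrite eq_sym.
have ji : j != i by rewrite eq_sym.
have kj : k != j by rewrite eq_sym.
have E : x i j ^ x j k = x i j * x i k by rewrite -R commgEl mulVKg.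
have cij : commute (x i j) (x i k) by apply: st.1.
have cjk : commute (x j k) (x i k) by apply: st.1.
have E' : x i j ^ (x j k)^-1 = x i j * (x i k)^-1.
  apply: (canRL (mulgK _)); have -> : x i k = x i k ^ (x j k)^-1.
    apply/esym/conjg_fixP/commgP; apply: commuteV; exact: commute_sym.
  by rewrite -conjMg -E conjgK.
case: a b => [] [] /=; rewrite ?conjVg ?E ?E' // !invgM ?invgK.
  exact: commuteV.
by apply: commuteV; apply: commute_sym; apply: commuteV; apply: commute_sym.
Qed.

Lemma xs_conj_r i j k a b : i != j -> j != k -> i != k ->
  signed j k b ^ signed i j a = signed j k b * signed i k (~~ (a (+) b)).
Proof.
move=> ij jk ik; have := xs_conj_l a b ij jk ik.
move=> /(congr1 (fun g => (signed i j a)^-1 * g));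
  rewrite mulKg -commgEl -xsV => <-.
by rewrite commgEl !conjgE !invgM !invgK !mulgA mulgV mul1g.
Qed.

Lemma xs_commg i j k a b : i != j -> j != k -> i != k ->
  [~ signed i j a, signed j k b] = signed i k (a (+) b).
Proof. by move=> *; rewrite commgEl xs_conj_l // mulKg. Qed.

(** Tells whether [weyl i j b] changes the sign of the basis vector e_k while
    permuting the basis vectors up to sign. *)
Definition neg_at i j b k := (b && (k == j)) (+) (~~ b && (k == i)).

(** Weyl elements permute the generators in the way their matrices permute the
    basis. When one of the two indices of the conjugated generator lies outside
    {i, j} this follows from three commutator relations. The generators x_ij and
    x_ji are first written as commutators through a third index; this is where
    rank at least 3 is needed. *)
Lemma wt_conj i j k l b c : i != j -> k != l ->
  signed k l c ^ weyl i j b =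
  signed (tperm i j k) (tperm i j l)
     (c (+) neg_at i j (~~ b) k (+) neg_at i j (~~ b) l).
Proof.
move=> ij; have ji : j != i by rewrite eq_sym.
have cancel (g h : G) : commute g h -> g * (h * g^-1) = h.
  by move=> gh; rewrite mulgA gh mulgK.
have main k' : k' != i -> k' != j ->
  [/\ forall c, signed i k' c ^ weyl i j b = signed j k' (c (+) b),
      forall c, signed j k' c ^ weyl i j b = signed i k' (c (+) ~~ b),
      forall c, signed k' i c ^ weyl i j b = signed k' j (c (+) b)
    & forall c, signed k' j c ^ weyl i j b = signed k' i (c (+) ~~ b)].
  move=> k'i k'j.
  have [ik' jk'] : i != k' /\ j != k' by rewrite !(eq_sym _ k').
  split=> d; rewrite /weyl !conjgM.
  - rewrite (@xs_conj_comm i k') // (@xs_conj_r j i k') // conjMg.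
    rewrite (@xs_conj_comm i k') // (@xs_conj_r i j k') //.
    rewrite [X in _ * (_ * X)](_ : _ = (signed i k' d)^-1).
      by rewrite cancel; [congr signed; case: b d => [] [] | apply: xs_comm].
    by rewrite xsV; congr signed; case: b d => [] [].
  - rewrite (@xs_conj_r i j k') // conjMg (@xs_conj_comm j k') //.
    rewrite (@xs_conj_r j i k') // [X in _ * (_ * X)](_ : _ = (signed j k'
      d)^-1).
      rewrite cancel; last exact: xs_comm.
      by rewrite (@xs_conj_comm i k') //; congr signed; case: b d => [] [].
    by rewrite xsV; congr signed; case: b d => [] [].
  - rewrite (@xs_conj_l k' i j) // conjMg (@xs_conj_comm k' i) //.
    rewrite (@xs_conj_l k' j i) // [X in _ * (_ * X)](_ : _ = (signed k' i
      d)^-1).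
      rewrite cancel; last exact: xs_comm.
      by rewrite (@xs_conj_comm k' j) //; congr signed; case: b d => [] [].
    by rewrite xsV; congr signed; case: b d => [] [].
  rewrite (@xs_conj_comm k' j) // (@xs_conj_l k' j i) // conjMg.
  rewrite (@xs_conj_comm k' j) // (@xs_conj_l k' i j) //.
  rewrite [X in _ * (_ * X)](_ : _ = (signed k' j d)^-1).
    by rewrite cancel; [congr signed; case: b d => [] [] | apply: xs_comm].
  by rewrite xsV; congr signed; case: b d => [] [].
rewrite /neg_at negbK.
case: (eqVneq k i) => [->|ki]; [|case: (eqVneq k j) => [->|kj]].
- case: (eqVneq l j) => [->|lj] il.
    have [m /andP[mi mj]] := third i j; have [im jm] : i != m /\ j != m
      by rewrite !(eq_sym _ m).
    have -> : signed i j c = [~ signed i m c,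
      signed m j false] by rewrite xs_commg // addbF.
    have [E1 E2 E3 E4] := main m mi mj.
    rewrite conjRg E1 E4 xs_commg // tpermL tpermR ?eqxx ?(negPf ij) ?(negPf
      ji).
    by congr signed; case: (b) (c) => [] [].
  have li : l != i by rewrite eq_sym.
  have [-> _ _ _] := main l li lj.
  rewrite tpermL tpermD ?[i == l]eq_sym ?[j == l]eq_sym //
    ?eqxx ?(negPf ij) ?(negPf li) ?(negPf lj).
  by congr signed; case: (b) (c) => [] [].
- case: (eqVneq l i) => [->|li] jl.
    have [m /andP[mi mj]] := third i j; have [im jm] : i != m /\ j != m
      by rewrite !(eq_sym _ m).
    have -> : signed j i c = [~ signed j m c,
      signed m i false] by rewrite xs_commg // addbF.
    have [E1 E2 E3 E4] := main m mi mj.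
    rewrite conjRg E2 E3 xs_commg // tpermL tpermR ?eqxx ?(negPf ij) ?(negPf
      ji).
    by congr signed; case: (b) (c) => [] [].
  have lj : l != j by rewrite eq_sym.
  have [_ -> _ _] := main l li lj.
  rewrite tpermR tpermD ?[i == l]eq_sym ?[j == l]eq_sym //
    ?eqxx ?(negPf ji) ?(negPf li) ?(negPf lj).
  by congr signed; case: (b) (c) => [] [].
have [E1 E2 E3 E4] := main k ki kj.
rewrite tpermD ?[i == k]eq_sym ?[j == k]eq_sym //
  ?(negPf ki) ?(negPf kj) !andbF !addbF.
case: (eqVneq l i) => [->|li]; [|case: (eqVneq l j) => [->|lj]] => kl.
- by rewrite E3 tpermL ?(negPf ij); congr signed; case: (b) (c) => [] [].
- by rewrite E4 tpermR; congr signed; case: (b) (c) => [] [].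
rewrite tpermD ?[i == l]eq_sym ?[j == l]eq_sym // !andbF !addbF /weyl !conjgM.
by rewrite !xs_conj_comm // eq_sym.
Qed.

Lemma wt_conj_wt i j k l b c : i != j -> k != l ->
  weyl k l c ^ weyl i j b =
  weyl (tperm i j k) (tperm i j l)
     (c (+) neg_at i j (~~ b) k (+) neg_at i j (~~ b) l).
Proof.
move=> ij kl; rewrite {1}/weyl !conjMg !wt_conj // 1?eq_sym //.
by rewrite /weyl; congr (_ * signed _ _ _ * _); rewrite addNb addbAC !addNb.
Qed.

(** Conjugating a Weyl element by itself gives this. *)
Lemma wt_sym i j b : i != j -> weyl j i b = weyl i j (~~ b).
Proof.
move=> ij; have := wt_conj_wt b (~~ b) ij ij.
rewrite -{1}wtV conjVg conjgE mulKg wtV => ->.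
by rewrite tpermL tpermR /neg_at !eqxx (negPf ij) [j == i]eq_sym (negPf ij);
  congr weyl; case: b.
Qed.

Lemma wt_mul_xs i j k l b c : i != j -> k != l ->
  weyl i j b * signed k l c =
  signed (tperm i j k) (tperm i j l)
     (c (+) neg_at i j b k (+) neg_at i j b l) * weyl i j b.
Proof.
move=> ij kl; have := wt_conj (~~ b) c ij kl.
by rewrite -wtV negbK conjgE invgK mulgA => <-; rewrite mulgVK.
Qed.

Lemma wt_mul_wt i j k l b c : i != j -> k != l ->
  weyl i j b * weyl k l c =
  weyl (tperm i j k) (tperm i j l)
     (c (+) neg_at i j b k (+) neg_at i j b l) * weyl i j b.
Proof.
move=> ij kl; have := wt_conj_wt (~~ b) c ij kl.
by rewrite -wtV negbK conjgE invgK mulgA => <-; rewrite mulgVK.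
Qed.

(** All Weyl elements are conjugate up to inversion, so one relation suffices. *)
Lemma wt_pow4 i0 j0 : i0 != j0 -> (forall b, weyl i0 j0 b ^+ 4 = 1) ->
  forall i j b, i != j -> weyl i j b ^+ 4 = 1.
Proof.
move=> ij0 w0.
have sym i j : i != j -> (forall b, weyl i j b ^+ 4 = 1) ->
    forall b, weyl j i b ^+ 4 = 1.
  by move=> ij w b; rewrite wt_sym.
have movel i j k : i != j -> k != j -> (forall b, weyl i j b ^+ 4 = 1) ->
    forall b, weyl k j b ^+ 4 = 1.
  move=> ij kj; have [->//|ki] := eqVneq k i; move=> w b.
  have ik : i != k by rewrite eq_sym.
  have := congr1 (conjg^~ (weyl i k false)) (w b); rewrite /= conjXg conj1g.
  rewrite wt_conj_wt // tpermL tpermD // /neg_at /=.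
  by rewrite (negPf ik) [j == k]eq_sym (negPf kj) !addbF.
have mover i j k : i != j -> k != i -> (forall b, weyl i j b ^+ 4 = 1) ->
    forall b, weyl i k b ^+ 4 = 1.
  move=> ij ki w; apply: (sym _ _) => //; apply: (movel j) => //;
    first by rewrite eq_sym.
  exact: sym.
move=> k l b kl; have [k0|k0] := eqVneq k j0; last first.
  have := movel i0 j0 k ij0 k0 w0; move=> /(mover k j0 l k0); apply.
  by rewrite eq_sym.
move: kl; rewrite {}k0 => kl; have := sym _ _ ij0 w0; rewrite eq_sym in ij0.
by move=> /(mover j0 i0 l ij0); apply; rewrite eq_sym.
Qed.

End Steinberg.

(** * Generation of subgroups *)
Section Gen.
Variable G : groupType.
Implicit Types (A : G -> Prop) (g h : G).

(** Products of elements of [A]. All the sets [A] used below are closed under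
    inverses, so that this is the subgroup generated by [A], with an induction
    principle by left multiplication. *)
Inductive gen A : G -> Prop :=
| gen_one : gen A 1
| gen_cons a g of A a & gen A g : gen A (a * g).

Lemma gen_incl A a : A a -> gen A a.
Proof. by move=> Aa; rewrite -[a]mulg1; apply: gen_cons => //;
  apply: gen_one. Qed.

Lemma gen_mul A g h : gen A g -> gen A h -> gen A (g * h).
Proof.
move=> Ag Ah; elim: Ag => [|a g' Aa _ IH]; first by rewrite mul1g.
by rewrite -mulgA; apply: gen_cons.
Qed.

Lemma gen_inv A g : (forall a, A a -> A a^-1) -> gen A g -> gen A g^-1.
Proof.
move=> AV; elim=> [|a g' Aa _ IH]; first by rewrite invg1; apply: gen_one.
by rewrite invgM; apply: gen_mul => //; apply/gen_incl/AV.
Qed.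

End Gen.

(** * Elementary integer matrices *)
Section Matrices.
Variable n : nat.
Implicit Types (i j k l c : 'I_n) (A B : SLZ n).

Definition ent A i j : int := sl_mx A i j.

Lemma ent_inj A B : (forall i j, ent A i j = ent B i j) -> A = B.
Proof. by move=> AB; apply/val_inj/matrixP => i j; apply: AB. Qed.

Lemma ent1 i j : ent 1 i j = (i == j)%:R%R.
Proof. by rewrite /ent mxE. Qed.

(** For i = j the matrix I + E_ii has determinant 2 and the default value 1 is
    taken. *)
Definition elemSL i j : SLZ n := insubd (1 : SLZ n) (Tmx n i.+1 j.+1).

Lemma val_elemSL i j : i != j -> sl_mx (elemSL i j) = Tmx n i.+1 j.+1.
Proof. by move=> ij; rewrite insubdK // unfold_in; apply: det_Tmx. Qed.

Lemma ent_T i j A k c : i != j ->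
  ent (elemSL i j * A) k c =
  (ent A k c + (if k == i then ent A j c else 0))%R.
Proof.
move=> ij; rewrite /ent /= val_elemSL // mulmxDl mul1mx mxE; congr (_ + _)%R.
rewrite mxE (bigD1 j) //= mxE !eqSS eqxx andbT big1 ?addr0 => [|l lj].
  by rewrite val_eqE; case: eqP => _; rewrite ?mul1r ?mul0r.
by rewrite mxE !eqSS !val_eqE (negPf lj) andbF mul0r.
Qed.

Definition signz (b : bool) (z : int) : int := if b then (- z)%R else z.

Lemma absz_signz b z : `|signz b z|%N = `|z|%N.
Proof. by case: b; rewrite /= ?abszN. Qed.

Lemma ent_xs i j b A k c : i != j ->
  ent (signed elemSL i j b * A) k c =
  (ent A k c + (if k == i then signz b (ent A j c) else 0))%R.
Proof.
move=> ij; case: b; rewrite /signed /signz; last exact: ent_T.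
rewrite -{2 3}[A](mulVKg (elemSL i j)) !ent_T // [j == i]eq_sym (negPf ij).
by case: ifP => _; rewrite ?addr0 ?addrK.
Qed.

Lemma ent_weyl i j b A k c : i != j ->
  ent (weyl elemSL i j b * A) k c =
  signz (neg_at i j b (tperm i j k)) (ent A (tperm i j k) c).
Proof.
move=> ij; have ji : j != i by rewrite eq_sym.
rewrite /weyl -!mulgA /neg_at.
case: tpermP => [->|->|/eqP ki /eqP kj];
  rewrite !ent_xs // ?eqxx ?(negPf ij) ?(negPf ji).
- by case: b => /=; lia.
- by case: b => /=; lia.
by rewrite (negPf ki) (negPf kj) !andbF /= !addr0.
Qed.

End Matrices.

(** * Silvester's reduction and the kernel of the map to matrices *)
Section Silvester.
Variables (n : nat) (G : groupType) (x : 'I_n -> 'I_n -> G).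
Variable phi : UMagmaMorphism.type G (SLZ n).
Implicit Types (i j k l : 'I_n) (a b c d : bool) (g h : G).

Hypothesis st : steinberg x.
Hypothesis n3 : 3 <= n.
Hypothesis w4 : forall i j b, i != j -> weyl x i j b ^+ 4 = 1.
Hypothesis phix : forall i j, i != j -> phi (x i j) = elemSL i j.

Local Notation xs := (signed x).
Local Notation wt := (weyl x).

Lemma third i j : exists k, (k != i) && (k != j).
Proof.
have : (0 < #|~: [set i; j]|)%N.
  by have := cardsC [set i; j]; rewrite card_ord cards2; lia.
by case/card_gt0P=> k; rewrite !inE negb_or => kij; exists k.
Qed.

Let st_sym := @wt_sym _ _ x st third.

Lemma wt_xs i j k l b c g : i != j -> k != l ->
  wt i j b * (xs k l c * g) =
  xs (tperm i j k) (tperm i j l)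
     (c (+) neg_at i j b k (+) neg_at i j b l) * (wt i j b * g).
Proof. by move=> ij kl; rewrite mulgA (wt_mul_xs st third) //;
  exact/esym/mulgA. Qed.

Lemma wt_wt i j k l b c g : i != j -> k != l ->
  wt i j b * (wt k l c * g) =
  wt (tperm i j k) (tperm i j l)
     (c (+) neg_at i j b k (+) neg_at i j b l) * (wt i j b * g).
Proof. by move=> ij kl; rewrite mulgA (wt_mul_wt st third) //;
  exact/esym/mulgA. Qed.

(** The same exchange as in [wt_wt], with the left factor conjugated instead. *)
Lemma wt_wt_conj i j k l b c g : i != j -> k != l ->
  wt k l c * (wt i j b * g) =
  wt i j b * (wt (tperm i j k) (tperm i j l)
     (c (+) neg_at i j (~~ b) k (+) neg_at i j (~~ b) l) * g).
Proof.
by move=> ij kl; rewrite -(wt_conj_wt st third) // conjgE !mulgA mulgV mul1g.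
Qed.

Lemma phi_xs i j b : i != j -> phi (xs i j b) = signed (@elemSL n) i j b.
Proof. by move=> ij; case: b; rewrite /signed ?gmulfV ?phix. Qed.

Lemma phi_wt i j b : i != j -> phi (wt i j b) = weyl (@elemSL n) i j b.
Proof. by move=> ij; rewrite /weyl !gmulfM !phi_xs // eq_sym. Qed.

Section Column.
Variable e : 'I_n.

(** The column g e_e. The generator x_ij^(+-1) adds to its entry i the entry j up
    to sign. *)
Definition coord g k : int := ent (phi g) k e.
Definition l1norm g : nat := (\sum_k `|coord g k|)%N.

Lemma coord1 k : coord 1 k = (k == e)%:R%R.
Proof. by rewrite /coord gmulf1 ent1. Qed.

Lemma coord_mul f g h : (forall k, coord g k = coord h k) ->
  forall k, coord (f * g) k = coord (f * h) k.
Proof.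
by move=> gh k; rewrite /coord /ent !gmulfM !mxE; apply: eq_bigr => l _;
  congr (_ * _)%R; apply: gh.
Qed.

Lemma coord_xs i j b g k : i != j ->
  coord (xs i j b * g) k = (coord g k + (if k == i then signz b (coord g j) else
    0))%R.
Proof. by move=> ij; rewrite /coord gmulfM phi_xs // ent_xs. Qed.

Lemma coord_xs_eq i j b g : i != j -> coord (xs i j b * g) i = (coord g i +
  signz b (coord g j))%R.
Proof. by move=> ij; rewrite coord_xs // eqxx. Qed.

Lemma coord_xs_ne i j b g k : i != j -> k != i ->
  coord (xs i j b * g) k = coord g k.
Proof. by move=> ij ki; rewrite coord_xs // (negPf ki) addr0. Qed.

Lemma l1norm_xs i j b g : i != j ->
  (l1norm (xs i j b * g) + `|coord g i| = l1norm g + `|(coord g i + signz b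
    (coord g j))%R|)%N.
Proof.
move=> ij; rewrite /l1norm (bigD1 i) //= [in RHS](bigD1 i) //= coord_xs_eq //.
rewrite (eq_bigr (fun k => `|coord g k|%N)) => [|k ki];
  last by rewrite coord_xs_ne.
by rewrite addnC addnA [in RHS]addnAC.
Qed.

Lemma coord_wt i j b g k : i != j ->
  coord (wt i j b * g) k = signz (neg_at i j b (tperm i j k)) (coord g (tperm i
    j k)).
Proof.
by move=> ij; rewrite /coord gmulfM phi_wt // ent_weyl.
Qed.

Lemma l1norm_wt i j b g : i != j -> l1norm (wt i j b * g) = l1norm g.
Proof.
move=> ij; rewrite /l1norm (reindex_inj (@perm_inj _ (tperm i j))).
by apply: eq_bigr => k _; rewrite coord_wt // tpermK absz_signz.
Qed.

(** In the block of indices up to e, the generators that fix e_e. *)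
Definition stab_gens g := exists i j b, [/\ i != j, i <= e,
  j < e & g = xs i j b].
Definition weyl_gens g := exists i j b, [/\ i != j, i <= e,
  j <= e & g = wt i j b].

Lemma stab_inv g : gen stab_gens g -> gen stab_gens g^-1.
Proof.
by apply: gen_inv => a [i [j [b [? ? ? ->]]]]; exists i, j, (~~ b); rewrite xsV.
Qed.

Lemma coord_stab p : gen stab_gens p -> forall k, coord p k = (k == e)%:R%R.
Proof.
elim=> [|a g [i [j [b [ij ie je ->]]]] _ IH] k; first exact: coord1.
have jne : j != e by rewrite -val_eqE ltn_eqF.
by rewrite coord_xs // !IH (negPf jne); case: b;
  rewrite /= ?oppr0 if_same addr0.
Qed.

Lemma coord_mul_stab g p : gen stab_gens p ->
  forall k, coord (g * p) k = coord g k.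
Proof.
move=> Pp k; rewrite -[in RHS](mulg1 g); apply: coord_mul => l.
by rewrite coord_stab // coord1.
Qed.

Lemma l1norm_mul_stab g p : gen stab_gens p -> l1norm (g * p) = l1norm g.
Proof. by move=> Pp; apply: eq_bigr => k _; rewrite coord_mul_stab. Qed.

Lemma stab_xs i j b : i != j -> i <= e -> j < e -> gen stab_gens (xs i j b).
Proof. by move=> *; apply: gen_incl; exists i, j, b. Qed.

Lemma stab_wt i j b : i != j -> i < e -> j < e -> gen stab_gens (wt i j b).
Proof.
move=> ij ie je; have ji : j != i by rewrite eq_sym.
by rewrite /weyl; do !apply: gen_mul; apply: stab_xs => //; apply: ltnW.
Qed.

Lemma wt_inv_wt i j b g : wt i j (~~ b) * (wt i j b * g) = g.
Proof. by rewrite -wtV mulKg. Qed.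

Lemma wt_pow3 i j b g : i != j -> wt i j b * (wt i j b * (wt i j b * g)) = wt i
  j (~~ b) * g.
Proof.
move=> ij; apply: (mulgI (wt i j b)); rewrite -{5}[b]negbK wt_inv_wt.
by have := w4 b ij; rewrite !expgSr expg0 mul1g !mulgA => ->; rewrite mul1g.
Qed.

(** The Weyl group carries e_e to the vectors e_e, +-e_i and -e_e, and the three
    forms are coset representatives for them. Multiplying a form by a Weyl
    element either conjugates it, or, when both involve the same pair of indices,
    changes the exponent of w_ie modulo 4. *)
Lemma weyl_cosets w : gen weyl_gens w ->
  [\/ gen stab_gens w,
      exists i b p, [/\ i < e, gen stab_gens p & w = wt i e b * p]
    | exists i b p, [/\ i < e, gen stab_gens p & w = wt i e b * (wt i e b *
      p)]].
Proof.
elim=> [|a g [i [j [b [ij ie je ->]]]] _ IH]; first by apply: Or31;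
  apply: gen_one.
wlog ilte : i j b ij ie je / i < e.
  move=> H; case: (ltnP i e) => [|ei]; first exact: H.
  have ji : j != i by rewrite eq_sym.
  have jlte : j < e by move: ji; rewrite -val_eqE /=; lia.
  by rewrite -[b]negbK -st_sym //; apply: H.
have ne k : k < e -> k != e by move=> ke; rewrite -val_eqE ltn_eqF.
have en k : k < e -> e != k by move=> ke; rewrite eq_sym ne.
have pe k l (m : 'I_n) : k < e -> l < e -> m < e -> tperm k l m < e.
  by case: tpermP => [->|->|].
have pe1 k l : k < e -> l < e -> tperm k l e = e by move=> ke le;
  rewrite tpermD ?ne.
case: (ltnP j e) => [jlte|].
  case: IH => [Pg|[k [c [p [ke Pp ->]]]]|[k [c [p [ke Pp ->]]]]].
  - by apply: Or31; apply: gen_mul => //; apply: stab_wt.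
  - apply: Or32; rewrite wt_wt // ?ne // pe1 //.
    by do 3!eexists; split; last reflexivity;
      [apply: pe | apply: gen_mul => //; apply: stab_wt].
  apply: Or33; rewrite 2!(wt_wt _ _ _ ij (ne k ke)) pe1 //.
  by do 3!eexists; split; last reflexivity; [apply: pe | apply: gen_mul => //;
    apply: stab_wt].
move=> ej; have {je ej}jE : j = e by apply/val_inj/eqP; rewrite eqn_leq je ej.
rewrite {}jE in ij *.
have swap k c h : k < e -> k != i ->
    exists2 d, True & wt i e b * (wt k e c * h) = wt k e c * (wt i k d * h).
  move=> ke ki; rewrite wt_wt_conj // ?ne //.
  by rewrite tpermR tpermD ?en ?[i == k]eq_sym //; eexists.
case: IH => [Pg|[k [c [p [ke Pp ->]]]]|[k [c [p [ke Pp ->]]]]].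
- by apply: Or32; exists i, b, g.
- have [->|ki] := eqVneq k i.
    have [->|bc] := eqVneq b c; first by apply: Or33; exists i, c, p.
    have {bc}-> : b = ~~ c by case: (b) (c) bc => [] [].
    by rewrite wt_inv_wt; apply: Or31.
  have [d _ ->] := swap k c p ke ki; apply: Or32; exists k, c, (wt i k d * p);
    split=> //.
  by apply: gen_mul => //; apply: stab_wt; rewrite // eq_sym.
have [->|ki] := eqVneq k i.
  apply: Or32; exists i; have [->|bc] := eqVneq b c.
    by exists (~~ c), p; rewrite wt_pow3 ?ne.
  have {bc}-> : b = ~~ c by case: (b) (c) bc => [] [].
  by exists c, p; rewrite wt_inv_wt.
have [ik ei] : i != k /\ e != i by rewrite eq_sym en.
have [d _ ->] := swap k c (wt k e c * p) ke ki.
rewrite (wt_wt _ _ _ ik) ?ne // tpermR pe1 // wt_wt_conj // ?ne //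
  tpermR tpermD ?en //.
apply: Or32; do 3!eexists; split; last reflexivity; first by [].
by apply: gen_mul; [|apply: gen_mul => //]; apply: stab_wt; rewrite // eq_sym.
Qed.

Lemma weyl_stab w : gen weyl_gens w -> coord w e = 1%R -> gen stab_gens w.
Proof.
move=> /weyl_cosets[//|[i [b [p [ie Pp ->]]]]|[i [b [p [ie Pp ->]]]]];
  have ine : i != e by rewrite -val_eqE ltn_eqF.
  by rewrite coord_wt // tpermR coord_stab // (negPf ine); case: neg_at.
rewrite !coord_wt // tpermR tpermL coord_stab //
  eqxx /neg_at !eqxx (negPf ine) eq_sym (negPf ine).
by case: b.
Qed.

(** Read from the outermost factor inwards, a derivation is a Euclidean reduction
    of the column g e_e to a unit vector, at each step of which the norm drops. *)
Inductive reach : G -> Prop :=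
| reach_weyl w of gen weyl_gens w : reach w
| reach_up i j b g of i != j & i <= e & j <= e & reach g
    & (l1norm g < l1norm (xs i j b * g))%N : reach (xs i j b * g).

(** Reachability of the coset of g modulo the stabilizer subgroup P. *)
Definition reach_mod g := exists2 p, gen stab_gens p & reach (g * p).

Lemma reachW g : reach g -> reach_mod g.
Proof. by exists 1; rewrite ?mulg1 //; apply: gen_one. Qed.

Lemma reach_mod_mul g p : gen stab_gens p -> reach_mod (g * p) -> reach_mod g.
Proof. by move=> Pp [q Pq]; exists (p * q);
  [apply: gen_mul | rewrite mulgA]. Qed.

Lemma reach_mod_up i j b g : i != j -> i <= e -> j <= e -> reach_mod g ->
  (l1norm g < l1norm (xs i j b * g))%N -> reach_mod (xs i j b * g).
Proof.
move=> ij ie je [p Pp rg] up; exists p => //; rewrite -mulgA.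
by apply: reach_up => //; rewrite mulgA !(l1norm_mul_stab _ Pp).
Qed.

(** The induction hypothesis of Silvester's argument: below norm N, the reachable
    cosets are closed under generators and Weyl elements. *)
Definition stable N := forall g, reach_mod g -> (l1norm g < N)%N ->
  (forall i j b, i != j -> i <= e -> j <= e -> (l1norm (xs i j b * g) < N)%N ->
     reach_mod (xs i j b * g)) /\
  (forall i j b, i != j -> i <= e -> j <= e -> reach_mod (wt i j b * g)).

(** Moving a generator x_ij across w conjugates it. If the new second index is e,
    then w e_e = +-e_j, so that x_ij did not fix the column of w. *)
Lemma xs_weyl w i j b : gen weyl_gens w -> i != j -> i <= e -> j <= e ->
  exists i' j' b', [/\ i' != j', i' <= e, j' <= e,
    forall g, xs i j b * (w * g) = w * (xs i' j' b' * g)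
    & j' = e -> coord w j != 0%R].
Proof.
move=> Ww; elim: Ww i j b => [|a w' [k [l [c [kl ke le ->]]]] _ IH] i j b ij ie
  je.
  by exists i, j, b; split=> // [g|->]; rewrite ?mul1g // coord1 eqxx.
have pe (m : 'I_n) : m <= e -> tperm k l m <= e by case: tpermP => [->|->|].
have [|||i' [j' [b' [ij' ie' je' E nz]]]] := IH (tperm k l i) (tperm k l j)
  (b (+) neg_at k l (~~ c) i (+) neg_at k l (~~ c) j);
    rewrite ?(inj_eq perm_inj) ?pe //.
exists i', j', b'; split=> // [g|/nz].
  rewrite -!mulgA -E -(wt_conj st third) // conjgE !mulgA; congr (_ * _ * _).
  by rewrite mulgV mul1g.
by rewrite coord_wt // -!absz_eq0 absz_signz.
Qed.

Lemma coord_weyl w i j : gen weyl_gens w -> i != j ->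
  coord w i = 0%R \/ coord w j = 0%R.
Proof.
move=> Ww; elim: Ww i j => [|a w' [k [l [c [kl ke le ->]]]] _ IH] i j ij.
  rewrite !coord1; case: (eqVneq i e) => [ie|_]; last by left.
  by right; rewrite -ie eq_sym (negPf ij).
have [|E|E] := IH (tperm k l i) (tperm k l j);
  first by rewrite (inj_eq perm_inj).
  by left; rewrite coord_wt // E; case: neg_at.
by right; rewrite coord_wt // E; case: neg_at.
Qed.

Lemma xs_inv_xs i j b g : xs i j (~~ b) * (xs i j b * g) = g.
Proof. by rewrite -xsV mulKg. Qed.

Lemma xs_inv_xs' i j b g : xs i j b * (xs i j (~~ b) * g) = g.
Proof. by rewrite -{1}[b]negbK xs_inv_xs. Qed.

Lemma xs_xs i j k l a b g : i != j -> k != l -> i != l -> j != k ->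
  xs i j a * (xs k l b * g) = xs k l b * (xs i j a * g).
Proof. by move=> *; rewrite !mulgA (xs_comm st). Qed.

Lemma xs_xs_chain i j k a b g : i != j -> j != k -> i != k ->
  xs j k b * (xs i j a * g) =
  xs i j a * (xs j k b * (xs i k (~~ (a (+) b)) * g)).
Proof.
move=> ij jk ik; rewrite [in RHS](mulgA (xs j k b)) -(xs_conj_r st) // conjgE.
by rewrite !mulgA mulgV mul1g.
Qed.

(** Subtracting one of two coordinates from the other can be done in two ways; the
    results differ by a further generator and a quarter turn in the plane of the
    two coordinates. *)
Lemma wt_turn i j b g : xs i j (~~ b) * (xs j i b * g) = wt i j (~~ b) * (xs i j
  b * g).
Proof. by rewrite /weyl negbK -!mulgA xs_inv_xs. Qed.

Section Confluence.
Variable N : nat.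
Hypothesis stN : stable N.

Lemma stable_xs i j b g : i != j -> i <= e -> j <= e ->
  (l1norm g < N)%N -> (l1norm (xs i j b * g) < N)%N ->
    reach_mod (xs i j b * g) <-> reach_mod g.
Proof.
move=> ij ie je gN xN; split=> rg; last by apply: (stN rg gN).1.
by rewrite -[g](xs_inv_xs i j b); apply: (stN rg xN).1 => //; rewrite xs_inv_xs.
Qed.

Lemma stable_wt i j b g : i != j -> i <= e -> j <= e ->
  (l1norm g < N)%N -> reach_mod (wt i j b * g) <-> reach_mod g.
Proof.
move=> ij ie je gN; split=> rg; last by apply: (stN rg gN).2.
have wN : (l1norm (wt i j b * g) < N)%N by rewrite l1norm_wt.
by rewrite -[g](wt_inv_wt i j b); apply: (stN rg wN).2.
Qed.

Variable g : G.
Hypothesis gN : (l1norm g <= N)%N.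
Local Notation decr i j b := (l1norm (xs i j b * g) < l1norm g)%N.

(** Moves with different targets, neither of which is the source of the other,
    commute, and the second still shortens after the first. *)
Lemma conf_comm i j b k l a :
  i != j -> i <= e -> j <= e -> k != l -> k <= e -> l <= e ->
  i != k -> i != l -> j != k -> decr i j b -> decr k l a ->
  reach_mod (xs i j b * g) <-> reach_mod (xs k l a * g).
Proof.
move=> ij ie je kl ke le ik il jk dA dB.
have ki : k != i by rewrite eq_sym.
have li : l != i by rewrite eq_sym.
have kj : k != j by rewrite eq_sym.
have dAB : (l1norm (xs k l a * (xs i j b * g)) < N)%N.
  have := l1norm_xs a (xs i j b * g) kl; rewrite !coord_xs_ne //.
  by move: (l1norm_xs a g kl); lia.
rewrite -(@stable_xs k l a (xs i j b * g)) //; last lia.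
by rewrite xs_xs // (@stable_xs i j b) //; [lia | rewrite xs_xs].
Qed.

(** For x_ij and x_ji the two results are related by a Weyl element and a further
    generator ([wt_turn]). *)
Lemma conf_opp i j b a : i != j -> i <= e -> j <= e -> decr i j b ->
  decr j i a ->
  reach_mod (xs i j b * g) <-> reach_mod (xs j i a * g).
Proof.
move=> ij ie je dA dB; have ji : j != i by rewrite eq_sym.
have ab : a = b.
  move: (l1norm_xs b g ij) (l1norm_xs a g ji) dA dB; clear.
  by case: (a) (b) => [] [] //=; lia.
rewrite {}ab in dB *.
rewrite -(@stable_wt i j (~~ b)) // -?wt_turn; last lia.
by rewrite (@stable_xs i j (~~ b)) //; [lia | rewrite wt_turn l1norm_wt //;
  lia].
Qed.

(** Let beta be the column of g, with entries taken positive for simplicity, and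
    beta_l <= beta_j. Subtracting beta_j from beta_i and then beta_l from beta_j
    gives the same as subtracting beta_l from both and then the new beta_j from
    beta_i; this is the relation [x_ij, x_jl] = x_il. *)
Lemma conf_same i j b l a : i != j -> i <= e -> j <= e -> i != l -> l <= e ->
  j != l ->
  (`|coord g l| <= `|coord g j|)%N -> decr i j b -> decr i l a ->
  reach_mod (xs i j b * g) <-> reach_mod (xs i l a * g).
Proof.
move=> ij ie je il le jl lj dA dB.
set d := ~~ (b (+) a).
have E h : xs j l d * (xs i j b * h) = xs i j b * (xs j l d * (xs i l a * h)).
  by rewrite xs_xs_chain //; congr (_ * (_ * (xs _ _ _ * _))); rewrite /d;
    case: (a) (b) => [] [].
have [ji li] : j != i /\ l != i by rewrite ![_ == i]eq_sym.
have nA := l1norm_xs b g ij; have nB := l1norm_xs a g il.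
have nDA := l1norm_xs d (xs i j b * g) jl.
have nDB := l1norm_xs d (xs i l a * g) jl.
rewrite !coord_xs_ne // in nDA nDB.
have lDA : (l1norm (xs j l d * (xs i j b * g)) < N)%N.
  by move: gN nA nB nDA lj dA dB; rewrite /d; clear; case: (a) (b) => [] [] /=;
    lia.
have lDB : (l1norm (xs j l d * (xs i l a * g)) < N)%N.
  by move: gN nA nB nDB lj dA dB; rewrite /d; clear; case: (a) (b) => [] [] /=;
    lia.
rewrite -(@stable_xs j l d (xs i j b * g)) //; last lia.
rewrite E (@stable_xs i j b) -?E // (@stable_xs j l d) //; lia.
Qed.

(** The source of one move is the target of the other. The two orders differ by
    x_kj. If entry j of the column of g is at most entry i in absolute value, the
    path through these stays short. If not, x_ji shortens too and is joined to both moves by the cases already treated. *)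
Lemma conf_chain i j b k a :
  i != j -> i <= e -> j <= e -> k != i -> k <= e -> k != j -> decr i j b ->
    decr k i a ->
  reach_mod (xs i j b * g) <-> reach_mod (xs k i a * g).
Proof.
move=> ij ie je ki ke kj dA dB.
have [ji ik jk] : [/\ j != i, i != k & j != k] by rewrite ![j == _]eq_sym [i ==
  k]eq_sym.
have nA := l1norm_xs b g ij; have nB := l1norm_xs a g ki.
case: (leqP `|coord g j| `|coord g i|) => cji; last first.
  have dC : decr j i b.
    by have := l1norm_xs b g ji; move: nA nB cji dA dB; clear;
      case: (a) (b) => [] [] /=; lia.
  by rewrite (@conf_opp i j b b) // (@conf_comm j i b k i a).
set d := ~~ (a (+) b).
have E h : xs i j b * (xs k i a * h) = xs k j d * (xs k i a * (xs i j b * h)).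
  by rewrite xs_xs_chain // -/d [in RHS]xs_xs //
    [xs k j d * (xs i j b * _)]xs_xs.
have nAB := l1norm_xs a (xs i j b * g) ki;
  have nBA := l1norm_xs b (xs k i a * g) ij.
rewrite coord_xs_ne // coord_xs_eq // in nAB; rewrite !coord_xs_ne // in nBA.
have lAB : (l1norm (xs k i a * (xs i j b * g)) < N)%N.
  by move: gN nA nB nAB cji dA dB; clear; case: (a) (b) => [] [] /=; lia.
have lBA : (l1norm (xs i j b * (xs k i a * g)) < N)%N.
  by move: gN nA nB nBA cji dA dB; clear; case: (a) (b) => [] [] /=; lia.
rewrite -(@stable_xs k i a (xs i j b * g)) //; last lia.
by rewrite -(@stable_xs k j d) // -?E // (@stable_xs i j b) //;
  clear -gN dA dB lAB lBA; lia.
Qed.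

(** Any two shortening moves from the same column are joined below its norm. *)
Lemma confluent i j b k l a :
  i != j -> i <= e -> j <= e -> k != l -> k <= e -> l <= e -> decr i j b ->
    decr k l a ->
  reach_mod (xs i j b * g) -> reach_mod (xs k l a * g).
Proof.
move=> ij ie je kl ke le dA dB; have [ki|ki] := eqVneq k i.
  rewrite {}ki in kl ke dB *; have [lj|lj] := eqVneq l j.
    rewrite {}lj in kl le dB *; have -> // : a = b.
    have nA := l1norm_xs b g ij; have nB := l1norm_xs a g ij.
    by move: nA nB dA dB; case: (a) (b) => [] [] //=; lia.
  have jl : j != l by rewrite eq_sym.
  case: (leqP `|coord g l| `|coord g j|) => [|/ltnW] c.
    by rewrite (@conf_same i j b l a).
  by rewrite -(@conf_same i l a j b) // eq_sym.
have ik : i != k by rewrite eq_sym.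
have [li|li] := eqVneq l i.
  rewrite {}li in kl le dB *; have [kj|kj] := eqVneq k j.
    by rewrite {}kj in kl ki ik ke dB *; rewrite (@conf_opp i j b a).
  by rewrite (@conf_chain i j b k a).
have il : i != l by rewrite eq_sym.
have [kj|kj] := eqVneq k j; last by rewrite (@conf_comm i j b k l a) // eq_sym.
rewrite {}kj in kl ki ik ke dB *.
by rewrite (@conf_chain j l a i b).
Qed.

End Confluence.

Lemma reach_up_neq0 k l c h : k != l -> (l1norm h < l1norm (xs k l c * h))%N ->
  coord (xs k l c * h) k != 0%R /\ coord (xs k l c * h) l != 0%R.
Proof.
move=> kl; have := l1norm_xs c h kl; have lk : l != k by rewrite eq_sym.
by rewrite coord_xs_eq // coord_xs_ne //; case: (c) => /=; lia.
Qed.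

(** A shortening move is handled by [confluent] against the last step of a
    derivation of g, and a Weyl element by moving it inside that step. A generator
    that keeps the norm either fixes the column, and then commutes with the last
    step up to generators that also fix the column, or negates one entry, and then
    it is a Weyl element up to shortening moves. *)
Lemma stableS N : stable N -> stable N.+1.
Proof.
move=> stN.
have Rd f : reach f -> (l1norm f < N.+1)%N ->
  (forall i j b, i != j -> i <= e -> j <= e -> reach_mod (xs i j b * f)) /\
  (forall i j b, i != j -> i <= e -> j <= e -> reach_mod (wt i j b * f)).
  case=> [w Ww _|k l c h kl ke le rh up gN]; last set g := xs k l c * h.
    split=> i j b ij ie je; last by apply/reachW/reach_weyl/gen_cons => //;
      exists i, j, b.
    case: (ltnP (l1norm w) (l1norm (xs i j b * w))) => [|le];
      first exact/reach_mod_up/reachW/reach_weyl.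
    (* No norm increase at a unit vector means that the generator fixes it. *)
    have wj0 : coord w j = 0%R.
      have [wi0|//] := coord_weyl Ww ij.
      by have := l1norm_xs b w ij; rewrite wi0; move: le; case: (b) => /=; lia.
    have [i' [j' [b' [ij' ie' je' E nz]]]] := xs_weyl b Ww ij ie je.
    have jlte' : j' < e.
      by rewrite ltn_neqAle je' andbT val_eqE; apply/eqP => /nz;
        rewrite wj0 eqxx.
    exists (xs i' j' (~~ b')); first exact: stab_xs.
    have := E (xs i' j' (~~ b')); rewrite mulgA => ->.
    by rewrite -xsV mulgV mulg1; apply: reach_weyl.
  have hN : (l1norm h < N)%N by rewrite (leq_trans up).
  have Rh := reachW rh.
  have lk : l != k by rewrite eq_sym.
  have [gk0 gl0] : coord g k != 0%R /\ coord g l != 0%R by apply: reach_up_neq0.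
  split=> i j b ij ie je; last first.
    rewrite wt_xs //; apply: reach_mod_up; rewrite ?(inj_eq perm_inj) //.
    - by case: tpermP => // ->.
    - by case: tpermP => // ->.
    - by apply: (stN h Rh hN).2.
    by rewrite -wt_xs // !l1norm_wt.
  have dec (m p : 'I_n) d : m != p -> m <= e -> p <= e ->
      (l1norm (xs m p d * g) < l1norm g)%N -> reach_mod (xs m p d * g).
    move=> mp me pe down; apply: (@confluent N stN g gN k l (~~ c) m p d) => //.
      by rewrite xs_inv_xs.
    by rewrite xs_inv_xs.
  case: (ltngtP (l1norm g) (l1norm (xs i j b * g))) => [up'|down|eqn];
    [|exact: dec|].
    by apply: reach_mod_up => //; exists 1; rewrite ?mulg1;
      [apply: gen_one | apply: reach_up].
  have ji : j != i by rewrite eq_sym.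
  have nG := l1norm_xs b g ij.
  (* Equal norms: entry j vanishes, or it is twice entry i up to sign. *)
  have [gj0|gj0] := eqVneq (coord g j) 0%R.
    have jk : j != k by apply: contraNneq gk0 => <-; apply/eqP.
    have jl : j != l by apply: contraNneq gl0 => <-; apply/eqP.
    have kj : k != j by rewrite eq_sym.
    have hj0 : coord h j = 0%R by rewrite -gj0 coord_xs_ne.
    have fix_norm m d f1 : m != j -> coord f1 j = 0%R ->
      l1norm (xs m j d * f1) = l1norm f1.
      move=> mj fj; have := l1norm_xs d f1 mj; rewrite fj; case: (d) => /=; lia.
    have fix_coord m d f1 : m != j -> coord f1 j = 0%R ->
      coord (xs m j d * f1) j = 0%R.
      by move=> mj fj; rewrite coord_xs_ne // eq_sym.
    (* The generators x_mj fix a column whose entry j is 0. *)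
    have [li|li] := eqVneq l i.
      rewrite /g li in gl0 kl lk up eqn *.
      rewrite xs_xs_chain // in eqn *; apply: reach_mod_up => //; last first.
        by rewrite -eqn !fix_norm // fix_coord.
      have Rk := (stN h Rh hN).1 k j (~~ (c (+) b)) kj ke je.
      rewrite fix_norm // in Rk.
      have := stN _ (Rk hN); rewrite fix_norm // => /(_ hN) [A _];
        apply: A => //.
      by rewrite !fix_norm // fix_coord.
    have il : i != l by rewrite eq_sym.
    rewrite /g xs_xs // in eqn *; apply: reach_mod_up => //; last first.
      by rewrite -eqn fix_norm.
    by apply: (stN h Rh hN).1; rewrite // fix_norm.
  (* x_ij negates entry i, while x_ji of the same sign shortens. *)
  have nC := l1norm_xs b g ji.
  have lC : (l1norm (xs j i b * g) < l1norm g)%N.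
    by move: nG nC eqn gj0; clear; case: (b) => /=; lia.
  rewrite -(xs_inv_xs' j i b (xs i j b * g)) wt_turn.
  have RC := dec _ _ _ ji je ie lC.
  apply: reach_mod_up => //.
    exact: (stN _ RC (leq_trans lC gN)).2.
  by rewrite -wt_turn xs_inv_xs' -eqn wt_turn l1norm_wt.
move=> g [p Pp rp] gN; have [|A B] := Rd _ rp; first by rewrite l1norm_mul_stab.
split=> [i j b ij ie je _|i j b ij ie je]; apply: (reach_mod_mul Pp).
  by rewrite -(mulgA (xs i j b)); apply: A.
by rewrite -(mulgA (wt i j b)); apply: B.
Qed.

Lemma stable_all N : stable N.
Proof. by elim: N => [g|N]; [rewrite ltn0 | apply: stableS]. Qed.

Lemma reach_mod_xs i j b g : i != j -> i <= e -> j <= e -> reach_mod g ->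
  reach_mod (xs i j b * g).
Proof.
move=> ij ie je Rg; pose N := (l1norm g + l1norm (xs i j b * g)).+1.
have gN : (l1norm g < N)%N by rewrite ltnS leq_addr.
by apply: (stable_all Rg gN).1; rewrite // ltnS leq_addl.
Qed.

Lemma weyl_gens_inv w : gen weyl_gens w -> gen weyl_gens w^-1.
Proof.
by apply: gen_inv => a [i [j [b [? ? ? ->]]]]; exists i, j, (~~ b); rewrite wtV.
Qed.

(** Strip the last step of a derivation of g from both elements: closure under
    generators keeps the other one reachable. The descent ends in two Weyl
    elements, because a column produced by a last step has two nonzero entries. *)
Lemma reach_unique g h : reach g -> reach h ->
  (forall k, coord g k = coord h k) ->
  gen stab_gens (g^-1 * h).
Proof.
move=> rg; elim: rg h => [w Ww h rh|i j b g' ij ie je _ IH up h rh] E.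
  case: rh E => [w' Ww'|i j b h' ij ie je _ up] E.
    apply: weyl_stab; first by apply: gen_mul => //; apply: weyl_gens_inv.
    by rewrite -(coord_mul _ E) mulVg coord1 eqxx.
  have [] := reach_up_neq0 ij up; rewrite -!E.
  by have [->|->] := coord_weyl Ww ij; rewrite eqxx.
have [p Pp rp] := reach_mod_xs (~~ b) ij ie je (reachW rh).
have -> : (xs i j b * g')^-1 * h = g'^-1 * (xs i j (~~ b) * h * p) * p^-1.
  by rewrite invgM xsV !mulgA mulgK.
apply: gen_mul (stab_inv Pp); apply: IH => // k.
by rewrite coord_mul_stab // -(coord_mul _ E) xs_inv_xs.
Qed.

Definition elem_gens m g := exists i j b, [/\ i != j, (i < m)%N,
  (j < m)%N & g = xs i j b].

Lemma stabilizer g : gen (elem_gens e.+1) g ->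
  (forall k, coord g k = (k == e)%:R%R) ->
  gen stab_gens g.
Proof.
move=> Lg ge.
have R1 : reach 1 by apply/reach_weyl/gen_one.
have [p Pp rp] : reach_mod g.
  elim: Lg => [|a h [i [j [b [ij ie je ->]]]] _ IH]; first exact: reachW.
  exact: reach_mod_xs.
have := reach_unique R1 rp; rewrite invg1 mul1g => H.
rewrite -[g](mulgK p); apply: gen_mul (stab_inv Pp); apply: H => k.
by rewrite coord_mul_stab // ge coord1.
Qed.

(** The unipotent radical of P in the block of indices up to e, filtered by the
    number of columns involved. *)
Definition row_gens r g := exists j b, [/\ j < e, (j < r)%N & g = xs e j b].

(** The radical is normalized by the smaller block, so that the two multiply to a
    group, which contains all generators of P. *)
Lemma stab_decomp g : gen stab_gens g ->
  exists u h, [/\ gen (row_gens n) u, gen (elem_gens e) h & g = u * h].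
Proof.
have ne k : k < e -> k != e by move=> ke; rewrite -val_eqE ltn_eqF.
have en k : k < e -> e != k by move=> ke; rewrite eq_sym ne.
have gU k d : k < e -> gen (row_gens n) (xs e k d).
  by move=> ke; apply: gen_incl; exists k, d; split.
have LU (y u : G) : elem_gens e y -> gen (row_gens n) u ->
  gen (row_gens n) (y * u * y^-1).
  move=> [i [j [b [ij ie je ->]]]]; elim=> [|_ v [k [c [ke kn ->]]] _ IH].
    by rewrite mulg1 mulgV; apply: gen_one.
  have -> : xs i j b * (xs e k c * v) * (xs i j b)^-1
      = (xs i j b * xs e k c * (xs i j b)^-1) * (xs i j b * v * (xs i j b)^-1).
    by rewrite !mulgA mulgVK.
  apply: gen_mul IH; have [ik|ik] := eqVneq i k; last first.
    by rewrite (xs_comm st) ?ne ?en // ?mulgK; exact: gU.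
  rewrite -{}ik; have E := xs_conj_l st c (~~ b) (en _ ie) ij (en _ je).
  rewrite conjgE xsV negbK mulgA in E; rewrite xsV E.
  by apply: gen_mul; apply: gU.
elim=> [|_ h [i [j [b [ij ie je ->]]]] _ [u [l [Uu Ll ->]]]].
  by exists 1, 1; split; [apply: gen_one | apply: gen_one | rewrite mulg1].
have [ieq|ine] := eqVneq i e.
  exists (xs i j b * u), l; split=> //; last by rewrite mulgA.
  by apply: gen_mul => //; rewrite ieq; apply: gU.
have La : elem_gens e (xs i j b).
  by exists i, j, b; split=> //; rewrite ltn_neqAle ie andbT val_eqE.
exists (xs i j b * u * (xs i j b)^-1), (xs i j b * l); split; first exact: LU.
  exact: gen_cons.
by rewrite !mulgA mulgVK.
Qed.

(** The radical is abelian, so the powers of x_er can be collected in front; the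
    exponent of x_er is s - t. *)
Lemma unipotent_split r (u : G) : gen (row_gens r.+1) u ->
  gen (row_gens r) u \/
  exists j s t v, [/\ j < e, j = r :> nat, gen (row_gens r) v
    & u = xs e j false ^+ s * (xs e j true ^+ t * v)].
Proof.
elim=> [|_ v [j [b [je jr ->]]] _ IH]; first by left; apply: gen_one.
have ej : e != j by rewrite eq_sym -val_eqE ltn_eqF.
move: jr; rewrite ltnS leq_eqVlt => /orP[/eqP jr|jr].
  right; case: IH => [Uv|[j' [s [t [w [je' jr' Uw ->]]]]]].
    case: b; first by exists j, 0%N, 1%N, v; rewrite expg0 expg1 mul1g.
    by exists j, 1%N, 0%N, v; rewrite expg0 expg1 mul1g.
  have {j' je' jr'}-> : j' = j by apply/val_inj; rewrite /= jr'.
  case: b; last by exists j, s.+1, t, w; rewrite expgS mulgA.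
  exists j, s, t.+1, w; split=> //; rewrite expgS !mulgA; congr (_ * _ * _).
  by apply: (@commuteX _ (xs e j true)); apply: (xs_comm st); rewrite // eq_sym.
case: IH => [Uv|[j' [s [t [w [je' jr' Uw ->]]]]]].
  by left; apply: gen_mul Uv; apply: gen_incl; exists j, b.
have ej' : e != j' by rewrite eq_sym -val_eqE ltn_eqF.
right; exists j', s, t, (xs e j b * w); split=> //.
  by apply: gen_mul Uw; apply: gen_incl; exists j, b.
have cX c m : commute (xs e j b) (xs e j' c ^+ m).
  by apply: commuteX; apply: (xs_comm st); rewrite // eq_sym.
by rewrite !mulgA cX -[_ * _ * xs e j' true ^+ t]mulgA cX !mulgA.
Qed.

End Column.

Lemma coord_expg e i j b s g : i != j -> coord e (xs i j b ^+ s * g) i =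
  (coord e g i + s%:Z * signz b (coord e g j))%R.
Proof.
move=> ij; have ji : j != i by rewrite eq_sym.
elim: s g => [|s IH] g; first by rewrite expg0 mul1g mul0r addr0.
rewrite expgSr -mulgA IH coord_xs_eq // coord_xs_ne //; case: (b) => /=; lia.
Qed.

Lemma coord_unipotent e r (u : G) : gen (row_gens e r) u ->
  forall (c j : 'I_n), j != e -> coord c u j = (j == c)%:R%R.
Proof.
elim=> [|_ v [k [b [ke _ ->]]] _ IH] c j je; first by rewrite coord1.
by rewrite coord_xs_ne // ?IH // eq_sym -val_eqE ltn_eqF.
Qed.

Lemma coord_unipotent_ge e r (u : G) : gen (row_gens e r) u ->
  forall c : 'I_n, (r <= c)%N -> coord c u e = (e == c)%:R%R.
Proof.
elim=> [|_ v [k [b [ke kr ->]]] Uv IH] c rc; first by rewrite coord1.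
have ek : e != k by rewrite eq_sym -val_eqE ltn_eqF.
rewrite coord_xs_eq // IH // (coord_unipotent Uv) 1?eq_sym //.
have /negPf-> : k != c by rewrite -val_eqE /= ltn_eqF // (leq_trans kr).
by case: b => /=; rewrite ?oppr0 addr0.
Qed.

(** The entries of row e are the exponents of the generators. *)
Lemma unipotent_inj e r (u : G) : gen (row_gens e r) u ->
  (forall c : 'I_n, coord c u e = (e == c)%:R%R) -> u = 1.
Proof.
elim: r u => [|r IH] u Uu ue; first by case: Uu ue => // a g [j [b []]].
case: (unipotent_split Uu) => [Ur|[j [s [t [v [je jr Uv uE]]]]]];
  first exact: IH.
have ej : e != j by rewrite eq_sym -val_eqE ltn_eqF.
have ne : j != e by rewrite eq_sym.
have coE (c : 'I_n) : coord c u e = (coord c v e + (s%:Z - t%:Z) * (j ==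
  c)%:R)%R.
  rewrite uE !coord_expg //; have -> f : coord c (xs e j true ^+ t * f) j =
    coord c f j.
    elim: t f {uE} => [|t IHt] f; first by rewrite expg0 mul1g.
    by rewrite expgSr -mulgA IHt coord_xs_ne.
  by rewrite (coord_unipotent Uv _ ne) /=; case: (j == c) => /=; lia.
have st_eq : s = t.
  by have := coE j; rewrite ue (coord_unipotent_ge Uv) ?jr // eqxx (negPf ej);
    lia.
have uv : u = v by rewrite uE st_eq mulgA -[true]/(~~ false) -xsV expVgn mulgV
  mul1g.
by rewrite uv; apply: IH => // c; rewrite -uv.
Qed.

Lemma coord_lower (e : 'I_n) h : gen (elem_gens e) h ->
  forall c : 'I_n, coord c h e = (e == c)%:R%R.
Proof.
elim=> [|_ g [i [j [b [ij ie je ->]]]] _ IH] c; first by rewrite coord1.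
by rewrite coord_xs_ne // eq_sym -val_eqE ltn_eqF.
Qed.

Lemma elem_gens_inv m g : gen (elem_gens m) g -> gen (elem_gens m) g^-1.
Proof.
by apply: gen_inv => a [i [j [b [? ? ? ->]]]]; exists i, j, (~~ b); rewrite xsV.
Qed.

(** An element of the kernel fixes e_e, hence is u h with u in the radical and h in
    the smaller block. Row e of h is that of the identity, hence so is that of u,
    and u = 1. *)
Lemma elem_gens_inj m g : (m <= n)%N -> gen (elem_gens m) g -> phi g = 1 ->
  g = 1.
Proof.
elim: m g => [|m IH] g mn Lg pg; first by case: Lg pg => // a h [i [j [b []]]].
pose e := Ordinal mn.
have ge k : coord e g k = (k == e)%:R%R by rewrite /coord pg ent1.
have /stab_decomp[u [h [Uu Lh gE]]] := @stabilizer e g Lg ge.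
have pu : phi u = phi h^-1.
  by rewrite gmulfV; apply: (mulIg (phi h)); rewrite -gmulfM -gE pg mulVg.
have u1 : u = 1.
  apply: (unipotent_inj Uu) => c; rewrite -(coord_lower (elem_gens_inv Lh)).
  by rewrite /coord pu.
rewrite gE u1 mul1g in pg *; apply: IH => //; exact: ltnW.
Qed.

Lemma steinberg_inj g : gen (elem_gens n) g -> phi g = 1 -> g = 1.
Proof. exact: elem_gens_inj. Qed.

End Silvester.

(** * The special linear group is generated by elementary matrices *)
Section Elementary.
Variable n : nat.
Implicit Types (i j k l : 'I_n) (A B : SLZ n).

Lemma steinberg_elemSL : steinberg (@elemSL n).
Proof.
split=> [i j k l ij kl il jk|i j k ij jk ik].
  have li : l != i by rewrite eq_sym.
  suff E A : elemSL i j * (elemSL k l * A) = elemSL k l * (elemSL i j * A).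
    by have := E 1; rewrite !mulg1.
  apply: ent_inj => r c; rewrite !ent_T // (negPf jk) (negPf li).
  by case: (r == i); case: (r == k); lia.
suff E A : elemSL i j * (elemSL j k * A) = elemSL j k * (elemSL i j * (elemSL i
  k * A)).
  apply: (mulgI (elemSL j k * elemSL i j)); rewrite -commgC.
  by have := E 1; rewrite !mulg1 mulgA.
have [ji ki kj] : [/\ j != i, k != i & k != j] by rewrite ![_ == i]eq_sym [k ==
  j]eq_sym.
apply: ent_inj => r c; rewrite !ent_T // eqxx (negPf ji) (negPf ki) ?(negPf kj).
have [->|ri] := eqVneq r i; first by rewrite (negPf ij); lia.
by case: (r == j); lia.
Qed.

Lemma wt_elemSL_pow4 i j b : i != j -> weyl (@elemSL n) i j b ^+ 4 = 1.
Proof.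
move=> ij; apply: ent_inj => k c; rewrite !expgS expg0 !ent_weyl // !tpermK.
have -> f g (z : int) : signz f (signz g (signz f (signz g z))) = z
  by case: f g => [] [] /=; rewrite ?opprK.
by [].
Qed.

Definition elementary := gen (elem_gens (@elemSL n) n).

Lemma elementary_xs i j b : i != j -> elementary (signed (@elemSL n) i j b).
Proof. by move=> ij; apply: gen_incl; exists i, j, b; split. Qed.

(** Elementary matrices with an arbitrary integer parameter. *)
Lemma transvection i j z : i != j -> exists2 p, elementary p &
  forall A k c, ent (p * A) k c = (ent A k c + (if k == i then z * ent A j c
    else 0))%R.
Proof.
move=> ij; have ji : j != i by rewrite eq_sym.
exists (signed (@elemSL n) i j (z < 0)%R ^+ `|z|).
  by elim: `|z|%N => [|s IH]; rewrite ?expgS;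
    [apply: gen_one | apply: gen_mul IH; apply: elementary_xs].
have zE : z = signz (z < 0)%R `|z|%:Z by rewrite /signz; case: ifP; lia.
move=> A k c; rewrite [z in RHS]zE; move: `|z|%N (z < 0)%R => s b {zE}.
elim: s A => [|s IH] A; first by rewrite expg0 mul1g; case: ifP; case: b => /=;
  rewrite ?oppr0 ?mul0r addr0.
rewrite expgSr -mulgA IH !ent_xs // (negPf ji).
by case: ifP => _; case: (b) => /=; lia.
Qed.

Definition standard_from m A := forall c : 'I_n, (m <= c)%N ->
  forall k, ent A k c = (k == c)%:R%R.

Lemma standard_mul m p A i j z :
  (forall A k c, ent (p * A) k c = (ent A k c + (if k == i then z * ent A j c
    else 0))%R) ->
  (j < m)%N -> standard_from m A -> standard_from m (p * A).
Proof.
move=> pE jm sA c mc k; rewrite pE !sA //.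
have /negPf-> : j != c by rewrite -val_eqE /= ltn_eqF // (leq_trans jm).
by rewrite mulr0 if_same addr0.
Qed.

Lemma elementary_cancel p A : elementary p -> elementary (p * A) ->
  elementary A.
Proof.
move=> Sp SpA; rewrite -[A](mulKg p); apply: gen_mul SpA; apply: gen_inv Sp.
by move=> a [i [j [b [? ? ? ->]]]]; exists i, j, (~~ b); rewrite xsV.
Qed.

(** With a 1 on the diagonal the other entries of column e are cleared one row at a
    time, the rows of index at least r being done. *)
Lemma clear_column (e : 'I_n) :
  (forall A, standard_from e A -> elementary A) ->
  forall A, standard_from e.+1 A -> ent A e e = 1%R -> elementary A.
Proof.
move=> IHe A sA Ae; suff: forall r, (r <= n)%N ->
  forall A, standard_from e.+1 A ->
    ent A e e = 1%R -> (forall k, (r <= k)%N -> k != e -> ent A k e = 0%R) ->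
      elementary A.
  by move=> /(_ n (leqnn n) A sA Ae); apply=> k; rewrite leqNgt ltn_ord.
elim=> [|r IH] rn {sA Ae} A sA Ae A0.
  apply: IHe => c; rewrite leq_eqVlt => /orP[/eqP/val_inj <- k|];
    last exact: sA.
  by have [->|ke] := eqVneq k e; rewrite ?Ae // A0.
pose k := Ordinal rn; have [ke|ke] := eqVneq k e.
  apply: IH => // [|l rl le]; first exact: ltnW.
  by apply: A0 => //; rewrite ltn_neqAle rl andbT -[r]/(val k) val_eqE ke
    eq_sym.
have [p Sp pE] := transvection (- ent A k e)%R ke.
apply: (elementary_cancel Sp); apply: IH; first exact: ltnW.
- exact: (standard_mul pE).
- by rewrite pE eq_sym (negPf ke) addr0.
move=> l rl le; rewrite pE Ae mulr1; case: eqP => [->|lk];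
  first by rewrite subrr.
rewrite addr0 A0 // ltn_neqAle rl andbT; apply/eqP => rl'.
by apply: lk; apply: val_inj.
Qed.

(** A unit entry off the diagonal makes the diagonal entry 1. If the unit sits on
    the diagonal, it first makes another entry 1; for e = 0 there is no other row in
    the block, but then the matrix is lower triangular and the determinant gives
    the sign. *)
Lemma clear_column_unit (e : 'I_n) (i : 'I_n) :
  (forall A, standard_from e A -> elementary A) -> i <= e ->
  forall A, standard_from e.+1 A -> (`|ent A i e| = 1)%N -> elementary A.
Proof.
move=> IHe ie A sA Ai.
(* B_ke = +-1 is its own inverse, so the parameter below gives B_ee = 1. *)
have unit_off k B : k < e -> standard_from e.+1 B -> (`|ent B k e| = 1)%N ->
  elementary B.
  move=> ke sB Bk; have ek : e != k by rewrite eq_sym -val_eqE ltn_eqF.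
  have [p Sp pE] := transvection ((1 - ent B e e) * ent B k e)%R ek.
  apply: (elementary_cancel Sp); apply: (clear_column IHe).
    by apply: (standard_mul pE) => //; apply: ltnW.
  rewrite pE eqxx -mulrA; have -> : (ent B k e * ent B k e = 1)%R by nia.
  by rewrite mulr1 addrC subrK.
case: (ltnP i e) => [|ei]; first by move=> ilte; apply: (unit_off i).
have {ie ei}iE : i = e by apply/val_inj/eqP; rewrite eqn_leq ie.
rewrite {}iE in Ai; have [e0|e0] := posnP e; last first.
  pose o := Ordinal (leq_ltn_trans (leq0n e) (ltn_ord e)).
  have oe : o != e by rewrite -val_eqE /= eq_sym -lt0n.
  have [p Sp pE] := transvection ((1 - ent A o e) * ent A e e)%R oe.
  apply: (elementary_cancel Sp); apply: (unit_off o) => //.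
    exact: (standard_mul pE).
  rewrite pE eqxx -mulrA; have -> : (ent A e e * ent A e e = 1)%R by nia.
  by rewrite mulr1 addrC subrK.
apply: (clear_column IHe sA).
have := sl_det A; rewrite det_trig; last first.
  apply/is_trig_mxP => k c kc; rewrite [LHS]sA;
    last by rewrite e0 (leq_ltn_trans _ kc).
  by rewrite -val_eqE /= ltn_eqF.
rewrite (bigD1 e) //= big1 ?mulr1 => [/eqP//|k ke]; rewrite [LHS]sA ?eqxx //.
by rewrite e0 lt0n -e0 val_eqE.
Qed.

Lemma standardV m A : standard_from m A -> standard_from m A^-1.
Proof.
move=> sA c mc k; have := congr1 (fun B => ent B k c) (mulVg A).
rewrite ent1 {1}/ent mxE => <-; rewrite (bigD1 c) //= big1 => [|l lc].
  by rewrite -/(ent A c c) sA // eqxx mulr1 addr0.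
by rewrite -/(ent A l c) sA // (negPf lc) mulr0.
Qed.

(** Column by column from the right. While two entries of the column within the
    block are nonzero, one of them can be diminished. When a single one is left, it
    is a unit, because row e of the inverse matrix pairs with the column to 1 and
    vanishes outside the block. *)
Lemma elementary_all A : elementary A.
Proof.
suff: forall m, (m <= n)%N -> forall A, standard_from m A -> elementary A.
  by move=> /(_ n (leqnn n)); apply=> c; rewrite leqNgt ltn_ord.
elim=> [|m IHm] mn {}A.
  by move=> sA; rewrite (_ : A = 1); [apply: gen_one | apply: ent_inj => i j;
    rewrite sA // ent1].
pose e := Ordinal mn; have {}IHm := IHm (ltnW mn).
pose colnorm B := (\sum_(k : 'I_n | (k <= e)%N) `|ent B k e|)%N.
have [N] := ubnP (colnorm A); elim: N A => // N IHN A muA sA.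
have [/existsP[i /existsP[j /and5P[ij ie je i0 j0]]]|none] :=
  boolP [exists i : 'I_n, exists j : 'I_n,
   [&& i != j, i <= e, j <= e, ent A i e != 0%R & ent A j e != 0%R]].
  wlog ji : i j ij ie je i0 j0 / (`|ent A j e| <= `|ent A i e|)%N.
    move=> W; case: (leqP `|ent A j e| `|ent A i e|) => [|/ltnW];
      first exact: W.
    by apply: W; rewrite // eq_sym.
  (* Subtract when the two entries have the same sign, add otherwise. *)
  pose b := ((0 <= ent A i e) == (0 <= ent A j e))%R.
  apply: (elementary_cancel (elementary_xs b ij)); apply: IHN; last first.
    have [p _ pE] := transvection (signz b 1)%R ij.
    have -> : signed (@elemSL n) i j b * A = p * A.
      apply: ent_inj => k c; rewrite pE ent_xs //; case: ifP => // _.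
      by case: (b) => /=; rewrite ?mulN1r ?mul1r.
    exact: (standard_mul pE).
  rewrite ltnS in muA; apply: leq_trans muA;
    rewrite /colnorm (bigD1 i) //= [X in (_ < X)%N](bigD1 i) //=.
  rewrite ent_xs // eqxx (eq_bigr (fun k => `|ent A k e|%N)) =>
    [|k /andP[_ /negPf ki]]; last first.
    by rewrite ent_xs // ki addr0.
  rewrite ltn_add2r; move: i0 j0 ji; rewrite /b;
    move: (ent A i e) (ent A j e) => x y; clear.
  by case: (lerP 0%R x) => ?; case: (lerP 0%R y) => ? /=; lia.
have E := congr1 (fun B => ent B e e) (mulVg A);
  rewrite /= ent1 eqxx {1}/ent mxE in E.
have V0 k : (e < k)%N -> sl_mx A^-1 e k = 0%R.
  by move=> ek; rewrite [LHS](standardV sA) // -val_eqE ltn_eqF.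
have [/existsP[i /andP[ie i0]]|none0] := boolP [exists i : 'I_n,
  (i <= e) && (ent A i e != 0%R)].
  apply: (@clear_column_unit e i IHm ie A sA).
  move: E; rewrite (bigD1 i) //= big1 ?addr0 => [E|k ki].
    by have /eqP := congr1 absz E; rewrite abszM muln_eq1 => /andP[_ /eqP].
  have [ke|ek] := leqP k e; last by rewrite V0 ?mul0r.
  suff /eqP : ent A k e == 0%R by rewrite /ent => ->; rewrite mulr0.
  apply: contraNT none => k0; apply/existsP; exists k; apply/existsP; exists i.
  by rewrite ki ke ie k0 i0.
suff E0 : (1 = 0 :> int)%R by [].
rewrite -[LHS]E big1 // => k _; have [ke|ek] := leqP k e;
  last by rewrite V0 ?mul0r.
have /eqP : ent A k e == 0%R.
  by apply: contraNT none0 => k0; apply/existsP; exists k; rewrite ke k0.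
by rewrite /ent => ->; rewrite mulr0.
Qed.

End Elementary.

(** * The words at the matrices a and b, and the orders of u and v *)
Section Generators.
Variable n : nat.
Hypothesis n3 : 3 <= n.
Implicit Types (i j k l : 'I_n) (A B : SLZ n).

Local Notation T := (@elemSL n).
Local Notation xs := (signed T).
Local Notation wt := (weyl T).
Local Notation a := (a_ n).
Local Notation b := (b_ n).
Local Notation eps := ((-1) ^+ n.-1 : int)%R.

Lemma ent_a k (k' : 'I_n) A c : k' = k.+1 :> nat ->
  ent (a * A) k c = ent A k' c.
Proof.
move=> kk'; rewrite /ent mxE (bigD1 k') //= big1 => [|l lk'].
  by rewrite a_mxE kk' eqxx andbF mulr0 !addr0 mul1r.
rewrite a_mxE -kk' val_eqE (negPf lk') add0r.
by rewrite (_ : k' == n :> nat = false) ?mulr0 ?mul0r //; have := ltn_ord k';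
  lia.
Qed.

Lemma ent_a_last k (o : 'I_n) A c : k.+1 = n -> o = 0%N :> nat ->
  ent (a * A) k c = (eps * ent A o c)%R.
Proof.
move=> kn o0; rewrite /ent mxE (bigD1 o) //= big1 => [|l lo].
  by rewrite a_mxE kn o0 !eqxx /= mulr1 addr0 (_ : 0%N == n = false) ?add0r //;
    lia.
rewrite a_mxE kn eqxx (_ : (l == 0%N :> nat) = false) ?mulr0 ?addr0; last first.
  by apply/negbTE; apply: contraNneq lo => l0; apply/eqP/val_inj; rewrite /= l0.
by rewrite (_ : l == n :> nat = false) ?mul0r //; have := ltn_ord l; lia.
Qed.

(** Conjugation by a shifts both indices by one; the next two lemmas treat an index
    that wraps around from n to 1, which brings in the sign (-1)^(n-1). *)
Lemma T_conj_a i j (i' j' : 'I_n) : i != j -> i' = i.+1 :> nat ->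
  j' = j.+1 :> nat ->
  T i j ^ a = T i' j'.
Proof.
move=> ij ii jj; have ij' : i' != j' by rewrite -val_eqE /= ii jj eqSS val_eqE.
apply: (mulgI a); rewrite -conjgC; apply: ent_inj => k c.
rewrite -[_ * a]mulg1 -[a * T i' j']mulg1 -!mulgA.
rewrite ent_T //; have [kn|kn] := ltnP k.+1 n.
  rewrite !(@ent_a k (Ordinal kn)) // (@ent_a j j') // ent_T //;
    congr (_ + _)%R.
  by rewrite -(inj_eq val_inj (Ordinal kn)) /= ii eqSS val_eqE.
have {}kn : k.+1 = n by have := ltn_ord k; lia.
pose o := Ordinal (leq_trans (isT : 0 < 3)%N n3).
rewrite !(@ent_a_last k o) // ent_T //.
have /negPf-> : k != i by apply/eqP => ki; have := ltn_ord i';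
  rewrite ii -ki kn ltnn.
have /negPf-> : o != i' by rewrite -val_eqE /= ii.
by rewrite !addr0.
Qed.

Lemma epsE z : (eps * z)%R = signz (~~ odd n) z.
Proof.
rewrite -signr_odd -subn1 oddB ?(leq_trans _ n3) //= addbT.
by case: odd; rewrite /= ?mul1r ?mulN1r.
Qed.

Lemma T_conj_a_wrap_l i j (j' o : 'I_n) :
  i.+1 = n -> o = 0%N :> nat -> i != j -> j' = j.+1 :> nat ->
  T i j ^ a = xs o j' (~~ odd n).
Proof.
move=> i_n o0 ij jj; have oj' : o != j' by rewrite -val_eqE /= o0 jj.
apply: (mulgI a); rewrite -conjgC; apply: ent_inj => k c.
rewrite -[_ * a]mulg1 -[a * xs _ _ _]mulg1 -!mulgA.
rewrite ent_T //; have [kn|kn] := ltnP k.+1 n.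
  rewrite !(@ent_a k (Ordinal kn)) // (@ent_a j j') // ent_xs //.
  have /negPf-> : k != i by apply/eqP => ki; rewrite ki i_n ltnn in kn.
  by have /negPf-> : Ordinal kn != o by rewrite -val_eqE /= o0.
have {}kn : k.+1 = n by have := ltn_ord k; lia.
have -> : k = i by apply: val_inj; apply: succn_inj; rewrite kn.
rewrite !(@ent_a_last i o) // (@ent_a j j') // ent_xs // !eqxx !epsE.
by case: odd => /=; lia.
Qed.

Lemma T_conj_a_wrap_r i j (i' o : 'I_n) :
  j.+1 = n -> o = 0%N :> nat -> i != j -> i' = i.+1 :> nat ->
  T i j ^ a = xs i' o (~~ odd n).
Proof.
move=> j_n o0 ij ii; have io' : i' != o by rewrite -val_eqE /= o0 ii.
apply: (mulgI a); rewrite -conjgC; apply: ent_inj => k c.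
rewrite -[_ * a]mulg1 -[a * xs _ _ _]mulg1 -!mulgA.
rewrite ent_T //; have [kn|kn] := ltnP k.+1 n.
  rewrite !(@ent_a k (Ordinal kn)) // (@ent_a_last j o) // ent_xs //.
  rewrite -(inj_eq val_inj (Ordinal kn)) /= ii eqSS val_eqE epsE.
  by case: ifP.
have {}kn : k.+1 = n by have := ltn_ord k; lia.
have -> : k = j by apply: val_inj; apply: succn_inj; rewrite kn.
rewrite !(@ent_a_last j o) // ent_xs //.
by rewrite [j == i]eq_sym (negPf ij) [o == i']eq_sym (negPf io') !addr0.
Qed.

Lemma b_T i j : i = 1%N :> nat -> j = 0%N :> nat -> b = T i j.
Proof.
move=> i1 j0; have ij : i != j by rewrite -val_eqE /= i1 j0.
by apply: val_inj; rewrite /= val_elemSL // i1 j0.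
Qed.

Lemma b_conjS (G : groupType) (x y : G) r : b_conj x y r.+2 = b_conj x y r.+1 ^
  x.
Proof. by rewrite /b_conj /= conjgE expgSr invgM !mulgA. Qed.

Lemma b_conj_T r i j : i = r.+1 :> nat -> j = r :> nat ->
  b_conj a b r.+1 = T i j.
Proof.
elim: r i j => [|r IH] i j ir jr.
  by rewrite /b_conj expg0 invg1 mul1g mulg1; apply: b_T.
have rn : (r.+1 < n)%N by rewrite -ir ltnW.
rewrite b_conjS (IH (Ordinal rn) (Ordinal (ltnW rn))) //.
by apply: T_conj_a => //; rewrite -val_eqE /= neq_ltn ltnSn orbT.
Qed.

(** The exponent in the definition of tau_1n cancels the wrap-around sign. *)
Lemma tau_1n_T (m o : 'I_n) : m.+1 = n -> o = 0%N :> nat ->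
  tau_1n n a b = T o m.
Proof.
move=> mn o0; have m1n : (m.-1 < n)%N by lia.
have -> : tau_1n n a b = if odd n then b_conj a b n else (b_conj a b n)^-1
  by [].
have nE : n = m.-1.+2 by lia.
have om : o != m by rewrite -val_eqE /=; lia.
have E : b_conj a b n = xs o m (~~ odd n).
  rewrite [X in b_conj _ _ X]nE b_conjS (@b_conj_T _ m (Ordinal m1n)) //=;
    last lia.
  by apply: T_conj_a_wrap_l => //=; [rewrite -val_eqE /=|]; lia.
by rewrite E; case: odd => //=; rewrite invgK.
Qed.

Lemma tau_low_T d i j : i = (j + d.+1)%N :> nat -> tau_low a b d j.+1 = T i j.
Proof.
elim: d i j => [|d IH] i j ijd; first by apply: b_conj_T; rewrite ?ijd; lia.
have jn : (j.+1 < n)%N by have := ltn_ord i; lia.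
rewrite /= -[j.+2]/((Ordinal jn).+1) (IH i) /=; last lia.
rewrite (@b_conj_T j (Ordinal jn) j) //.
by apply: (@steinberg_elemSL n).2; rewrite -val_eqE /=; lia.
Qed.

Lemma tau_last_T i (m : 'I_n) : m.+1 = n -> i != m ->
  tau_last n a b i.+1 = T i m.
Proof.
move=> mn im; have n0 : (0 < n)%N by lia.
pose o := Ordinal n0; rewrite /tau_last eqSS; case: eqP => [i0|/eqP i0].
  by rewrite (@tau_1n_T m i).
rewrite (@tau_1n_T m o) // (@tau_low_T _ i o) /=; last lia.
by apply: (@steinberg_elemSL n).2 => //; rewrite -val_eqE /=; lia.
Qed.

Lemma tau_T i j : i != j -> tau n a b i.+1 j.+1 = T i j.
Proof.
move=> ij; have n0 : (n.-1 < n)%N by lia.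
pose m := Ordinal n0; have mn : m.+1 = n by rewrite /=; lia.
rewrite /tau ltnS; case: ltnP => [ji|ij']; first by apply: tau_low_T; lia.
have im : i != m by have := ltn_ord j; rewrite -val_eqE; move: ij;
  rewrite -val_eqE /=; lia.
case: eqP => [jn|jn].
  by have -> : j = m; [apply: val_inj => /=; lia | apply: tau_last_T].
rewrite (@tau_last_T i m) // (@tau_low_T _ m) /=; last by have := ltn_ord j;
  lia.
by apply: (@steinberg_elemSL n).2; rewrite -?val_eqE /=; have := ltn_ord j;
  move: ij; rewrite -?val_eqE /=; lia.
Qed.

Lemma sigma_T i j : j = i.+1 :> nat -> sigma n a b i.+1 = wt i j false.
Proof.
move=> ji; have ij : i != j by rewrite -val_eqE /= ji; lia.
have ji' : j != i by rewrite eq_sym.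
have e2 : i.+2 = j.+1 by rewrite ji.
by rewrite /sigma e2 !tau_T.
Qed.

Lemma ent_wt i j A k c : i != j ->
  ent (wt i j false * A) k c =
  (if k == i then ent A j c else if k == j then - ent A i c else ent A k c)%R.
Proof.
move=> ij; rewrite ent_weyl // /neg_at.
case: tpermP => [->|->|/eqP ki /eqP kj].
- by rewrite !eqxx [j == i]eq_sym (negPf ij).
- by rewrite !eqxx [j == i]eq_sym (negPf ij).
by rewrite (negPf ki) (negPf kj).
Qed.

Variables o p m : 'I_n.
Hypotheses (o0 : o = 0%N :> nat) (p1 : p = 1%N :> nat) (mn : m.+1 = n).

Let po : p != o. Proof. by rewrite -val_eqE /= o0 p1. Qed.
Let mo : m != o. Proof. by rewrite -val_eqE /=; lia. Qed.
Let mp : m != p. Proof. by rewrite -val_eqE /=; lia. Qed.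
Let op : o != p. Proof. by rewrite eq_sym. Qed.
Let om : o != m. Proof. by rewrite eq_sym. Qed.
Let pm : p != m. Proof. by rewrite eq_sym. Qed.

Lemma v_T : v_ n = xs p o true * xs o p false.
Proof.
rewrite /v_ (@b_T p o) //; congr (_ * _); apply: val_inj.
by rewrite /= val_elemSL // ?o0 ?p1.
Qed.

(** The conjugate u v u^-1. It involves the indices n and 1, while v involves 1 and
    2, so W(u_n, v_n) lives on the three rows o, p, m of indices 1, 2, n. *)
Let P := xs o m (odd n) * xs m o (~~ odd n).

Lemma uvuV_T : u_ n * v_ n * (u_ n)^-1 = P.
Proof.
have po1 : p = o.+1 :> nat by rewrite o0.
suff -> : v_ n = P ^ a by rewrite conjgE !mulgA mulgV mul1g mulgK.
have Eo := T_conj_a_wrap_r mn o0 om po1.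
have Em := T_conj_a_wrap_l mn o0 mo po1.
rewrite v_T conjMg /P /signed; case: (odd n) Eo Em => /= Eo Em.
  by rewrite conjVg Eo Em.
by rewrite conjVg Eo Em /signed invgK.
Qed.

(** The effect of left multiplication by g on the rows o, p, m of any column, all
    other rows being fixed. *)
Definition row_map (g : SLZ n) (f : int -> int -> int -> int * int * int) :=
  forall A c, [/\ (ent (g * A) o c, ent (g * A) p c, ent (g * A) m c) =
                   f (ent A o c) (ent A p c) (ent A m c)
    & forall k, k != o -> k != p -> k != m -> ent (g * A) k c = ent A k c].

Lemma row_map_mul g h f f' : row_map g f -> row_map h f' ->
  row_map (g * h) (fun x y z => let: (x', y', z') := f' x y z in f x' y' z').
Proof.
move=> gf hf A c; rewrite -mulgA; have [E1 N1] := gf (h * A) c;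
  have [<- N2] := hf A c.
by split=> // k ko kp km; rewrite N1 // N2.
Qed.

Lemma row_map_v : row_map (v_ n) (fun x y z => (x + y, - x, z)%R).
Proof.
move=> A c; rewrite v_T -!mulgA; split=> [|k ko kp km].
  rewrite !ent_xs // !eqxx (negPf po) (negPf op) (negPf mo) (negPf mp) !addr0
    /=.
  by congr (_, _, _); lia.
by rewrite !ent_xs // (negPf ko) (negPf kp) !addr0.
Qed.

Lemma row_map_vV : row_map (v_ n)^-1 (fun x y z => (- y, x + y, z)%R).
Proof.
move=> A c; rewrite v_T invgM !xsV -!mulgA; split=> [|k ko kp km].
  rewrite !ent_xs // !eqxx (negPf po) (negPf op) (negPf mo) (negPf mp) !addr0
    /=.
  by congr (_, _, _); lia.
by rewrite !ent_xs // (negPf ko) (negPf kp) !addr0.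
Qed.

Lemma row_map_P : row_map P (fun x y z =>
  (signz (odd n) z, y, z - signz (odd n) x)%R).
Proof.
move=> A c; rewrite /P -!mulgA; split=> [|k ko kp km].
  rewrite !ent_xs // !eqxx (negPf po) (negPf mo) (negPf pm) (negPf om) !addr0.
  by case: (odd n) => /=; congr (_, _, _); lia.
by rewrite !ent_xs // (negPf ko) (negPf km) !addr0.
Qed.

Lemma row_map_PV : row_map P^-1 (fun x y z =>
  (x - signz (odd n) z, y, signz (odd n) x)%R).
Proof.
move=> A c; rewrite /P invgM !xsV negbK -!mulgA; split=> [|k ko kp km].
  rewrite !ent_xs // !eqxx (negPf po) (negPf mo) (negPf pm) (negPf om) !addr0.
  by case: (odd n) => /=; congr (_, _, _); lia.
by rewrite !ent_xs // (negPf ko) (negPf km) !addr0.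
Qed.

Lemma W_uv : W (u_ n) (v_ n) = b.
Proof.
have uvV : u_ n * (v_ n)^-1 * (u_ n)^-1 = P^-1.
  have E (x y : SLZ n) : x * y^-1 * x^-1 = (x * y * x^-1)^-1.
    by rewrite !invgM invgK mulgA.
  by rewrite E uvuV_T.
have -> : W (u_ n) (v_ n) = P * ((v_ n)^-1 * (P^-1 * ((v_ n)^-1 * (P * v_ n)))).
  by rewrite /W uvuV_T uvV !mulgA.
have R := row_map_mul row_map_P (row_map_mul row_map_vV (row_map_mul row_map_PV
  (row_map_mul row_map_vV (row_map_mul row_map_P row_map_v)))).
rewrite (@b_T p o) //; apply: ent_inj => k c;
  rewrite -[_ * (_ * _)]mulg1 -[T p o]mulg1.
rewrite ent_T //; have [/= [Eo Ep Em] N] := R 1 c.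
have [->|ko] := eqVneq k o; first by rewrite Eo (negPf op) addr0 !ent1 /signz;
  case: (odd n); lia.
have [->|kp] := eqVneq k p; first by rewrite Ep !ent1 /signz; case: (odd n);
  lia.
have [->|km] := eqVneq k m; first by rewrite Em addr0 !ent1 /signz;
  case: (odd n); lia.
by rewrite N // addr0.
Qed.

(** On the rows o and p, v acts as a matrix of order 6, and its first row tells the
    powers of exponent 1 to 5 from the identity. *)
Lemma order_v : has_order (v_ n) 6.
Proof.
have v2 := row_map_mul row_map_v row_map_v.
have v3 := row_map_mul row_map_v v2.
have v4 := row_map_mul row_map_v v3.
have v5 := row_map_mul row_map_v v4.
have v6 := row_map_mul row_map_v v5.
split=> //.
  apply: ent_inj => k c; rewrite !expgS expg0 mulg1 -[_ * (_ * _)]mulg1.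
  have [/= [Eo Ep Em] N] := v6 1 c.
  have [->|ko] := eqVneq k o; first by rewrite Eo !ent1; lia.
  have [->|kp] := eqVneq k p; first by rewrite Ep !ent1; lia.
  by have [->|km] := eqVneq k m; [rewrite Em | rewrite N].
have E g f : row_map g f -> g = 1 -> (f 1%R 0%R 0%R).1.1 = 1%R /\ (f 0%R 1%R
  0%R).1.1 = 0%R.
  move=> gf g1; have [E0 _] := gf 1 o; have [E1 _] := gf 1 p.
  move: E0 E1; rewrite g1 mulg1 !ent1 !eqxx (negPf op) (negPf po) (negPf mo)
    (negPf mp).
  by move=> <- <-.
case=> [|[|[|[|[|[|k]]]]]] //= _; rewrite !expgS expg0 mulg1 => /E.
- by move=> /(_ _ row_map_v)[].
- by move=> /(_ _ v2)[].
- by move=> /(_ _ v3)[].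
- by move=> /(_ _ v4)[].
by move=> /(_ _ v5)[].
Qed.

(** The product sigma_r ... sigma_1 carries e_1 along to (-1)^r e_(r+1) and
    shifts e_2, ..., e_(r+1) down by one. *)
Lemma a_factorization : a = \prod_(i <- rev (iota 1 n.-1)) sigma n a b i.
Proof.
suff H r : (r < n)%N -> forall k c,
  [/\ forall k' : 'I_n, (k < r)%N -> k' = k.+1 :> nat ->
       ent (\prod_(i <- rev (iota 1 r)) sigma n a b i) k c = ent 1 k' c,
      k = r :> nat ->
       ent (\prod_(i <- rev (iota 1 r)) sigma n a b i) k c = ((-1) ^+ r * ent
         1%g o c)%R
    & (r < k)%N ->
       ent (\prod_(i <- rev (iota 1 r)) sigma n a b i) k c = ent 1 k c].
  apply: ent_inj => k c; have n1 : (n.-1 < n)%N by lia.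
  have [H1 H2 _] := H _ n1 k c; transitivity (ent (a * 1) k c);
    first by rewrite mulg1.
  have [kn|kn] := ltnP k.+1 n.
    by rewrite (@ent_a k (Ordinal kn)) // (H1 (Ordinal kn)) //; lia.
  have {}kn : k.+1 = n by have := ltn_ord k; lia.
  by rewrite (@ent_a_last k o) // H2 //; lia.
elim: r => [|r IH] rn k c.
  by rewrite big_nil; split=> // k0; rewrite expr0 mul1r; congr ent;
    apply: val_inj; rewrite /= o0.
have {}IH := IH (ltnW rn).
have -> : iota 1 r.+1 = rcons (iota 1 r) r.+1.
  by rewrite -[in LHS](addn1 r) iotaD -cats1 add1n.
rewrite rev_rcons big_cons.
pose i := Ordinal (ltnW rn); pose j := Ordinal rn.
have ij : i != j by rewrite -val_eqE /=; lia.
rewrite (@sigma_T i j) //; move: (\prod_(_ <- _) _) IH => B IH.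
rewrite ent_wt //; split=> [k' kr kk'|kr|kr].
- have [ki|ki] := eqVneq k i.
    have [_ _ ->] := IH j c => //=; congr ent.
    by apply: val_inj; rewrite /= kk' ki.
  have /negPf-> : k != j by rewrite -val_eqE /=; lia.
  have [H _ _] := IH k c; apply: H => //; move: ki; rewrite -val_eqE /=; lia.
- have kj : k = j by apply: val_inj.
  rewrite kj eq_sym (negPf ij) eqxx; have [_ -> // _] := IH i c.
  by rewrite exprS mulN1r mulNr.
have /negPf-> : k != i by rewrite -val_eqE /=; lia.
have /negPf-> : k != j by rewrite -val_eqE /=; lia.
by have [_ _ -> //] := IH k c; lia.
Qed.

(** a^n = (-1)^(n-1) I, while for 0 < r < n the first row of a^r has its nonzero
    entry off the diagonal. *)
Lemma order_u : has_order (u_ n) (if odd n then n else (2 * n)%N).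
Proof.
have rowE r : (r < n)%N -> forall A (k l : 'I_n) c, (k + r = l)%N ->
  ent (a ^+ r * A) k c = ent A l c.
  elim: r => [|r IH] rn A k l c krl.
    by rewrite expg0 mul1g; congr ent; apply: val_inj; rewrite /= -krl addn0.
  have kn : (k.+1 < n)%N by have := ltn_ord l; lia.
  rewrite expgS -mulgA (@ent_a k (Ordinal kn)) // (IH _ _ _ l) //=;
    [exact: ltnW | lia].
have an A k c : ent (a ^+ n * A) k c = (eps * ent A k c)%R.
  have kn := ltn_ord k; have nk : n = (n.-1 - k + k.+1)%N by lia.
  have -> : a ^+ n = a ^+ (n.-1 - k) * (a * a ^+ k).
    by rewrite -expgS -expgnDr -nk.
  rewrite -!mulgA (rowE _ _ _ k m) //; try lia.
  by rewrite (@ent_a_last m o) // (rowE _ _ _ o k) // o0.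
have nE : (0 < n)%N by lia.
have epsV : eps = signz (~~ odd n) 1%R by rewrite -epsE // mulr1.
have low r : (0 < r < n)%N -> forall e : int, e != 0%R ->
  forall A, (forall c, ent A o c = (e * ent (a ^+ r * 1)%g o c)%R) -> A <> 1.
  move=> /andP[r0 rn] e e0 A AE A1; have := AE (Ordinal rn).
  rewrite A1 (rowE _ rn _ o (Ordinal rn)) ?o0 // !ent1 eqxx mulr1.
  by rewrite -val_eqE /= o0 eq_sym eqn0Ngt r0 /= => /eqP;
    rewrite eq_sym (negPf e0).
case: (boolP (odd n)) epsV => on epsV; split=> //; try lia.
- by apply: ent_inj => k c; rewrite -[_ ^+ n]mulg1 an epsV mul1r.
- by move=> r rn; apply: (low r rn 1%R) => // c; rewrite mul1r mulg1.
- apply: ent_inj => k c; rewrite mul2n -addnn expgnDr -[_ * _]mulg1 -mulgA !an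
    epsV /=.
  by rewrite !mulN1r opprK.
move=> r /andP[r0 r2]; case: (ltngtP r n) => rn.
- by apply: (low r _ 1%R); rewrite ?r0 // => c; rewrite mul1r mulg1.
- apply: (low (r - n)%N _ (-1)%R) => //; first lia.
  by move=> c; rewrite -{1}(subnKC (ltnW rn)) expgnDr -{1}[_ ^+ (r - n)]mulg1 an
    epsV.
rewrite rn => /(congr1 (fun A => ent A o o)).
by rewrite -[_ ^+ n]mulg1 an epsV ent1 eqxx.
Qed.

End Generators.

(** * Homomorphisms out of a presented group *)
Section FreeLift.
Variables (X : choiceType) (H : groupType) (f : X -> H).

Definition eval_letter (l : letter X) : H := if l.2 then f l.1 else (f l.1)^-1.
Definition eval_word (w : seq (letter X)) : H := \prod_(l <- w) eval_letter l.

Lemma eval_push l w : eval_word (push l w) = eval_letter l * eval_word w.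
Proof.
rewrite /eval_word; case: w => [|l' w] /=; first by rewrite !big_cons.
case: eqP => [->|_]; last by rewrite big_cons.
by rewrite big_cons /eval_letter /=; case: l => y [] /=; rewrite ?mulKg ?mulVKg.
Qed.

Lemma eval_reduce w : eval_word (reduce w) = eval_word w.
Proof.
elim: w => //= l w IH; rewrite eval_push IH; exact/esym/big_cons.
Qed.

Definition fg_lift (g : free_group X) : H := eval_word g.

Lemma fg_lift1 : fg_lift 1 = 1.
Proof. exact: big_nil. Qed.

Lemma fg_liftM : {morph fg_lift : g h / g * h}.
Proof. by move=> g h; rewrite /fg_lift /= eval_reduce; apply: big_cat. Qed.

HB.instance Definition _ := isUMagmaMorphism.Build (free_group X) H fg_lift
  (fg_lift1, fg_liftM).

Lemma fg_lift_gen y : fg_lift (fg_gen y) = f y.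
Proof. exact: big_seq1. Qed.

Variable R : seq (free_group X).
Hypothesis fR : forall r, r \in R -> fg_lift r = 1.

Lemma fg_lift_ncl g : normal_closure R g -> fg_lift g = 1.
Proof.
elim=> [r /fR//||g1 g2 _ E1 _ E2|g1 _ E|g1 g2 _ E].
- exact: gmulf1.
- by rewrite gmulfM /= E1 E2 mulg1.
- by rewrite gmulfV /= E invg1.
by rewrite gmulfJ /= E conj1g.
Qed.

(** The proof is a parameter so that the homomorphism structure can be attached to
    the function. *)
Definition pres_lift of (forall r, r \in R -> fg_lift r = 1) :=
  fun x : presented R => fg_lift (repr x).

Lemma pres_liftE g : pres_lift fR (pres_pi R g) = fg_lift g.
Proof.
have := fg_lift_ncl (pres_reprP R g); rewrite gmulfM gmulfV => E.
by apply: (mulgI (fg_lift g)^-1); rewrite E mulVg.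
Qed.

Lemma pres_lift1 : pres_lift fR 1 = 1.
Proof. by rewrite -[1]/(pres_pi R 1) pres_liftE gmulf1. Qed.

Lemma pres_liftM : {morph pres_lift fR : x y / x * y}.
Proof.
by move=> x y; rewrite -[x * y]/(pres_pi R (repr x * repr y)) pres_liftE gmulfM.
Qed.

HB.instance Definition _ := isUMagmaMorphism.Build (presented R) H (pres_lift
  fR) (pres_lift1, pres_liftM).

End FreeLift.

Section Presented.
Variables (X : choiceType) (R : seq (free_group X)).

Lemma pres_piM : {morph pres_pi R : g h / g * h}.
Proof. by move=> g h; rewrite -pres_mulE. Qed.

HB.instance Definition _ :=
  isUMagmaMorphism.Build (free_group X) (presented R) (pres_pi R) (erefl,
    pres_piM).

Lemma pres_pi_relator r : r \in R -> pres_pi R r = 1.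
Proof. by move=> Rr; apply/esym/pres_piP; rewrite invg1 mul1g;
  apply: ncl_rel. Qed.

Lemma fg_of_letter (y : X) (c : bool) :
  fg_of [:: (y, c)] = if c then fg_gen y else (fg_gen y)^-1 :> free_group X.
Proof. by case: c; apply: val_inj. Qed.

(** Induction over words in the generators and their inverses. *)
Lemma pres_ind (S : presented R -> Prop) :
  S 1 -> (forall y c g, S g -> S ((if c then pres_gen R y else (pres_gen R
    y)^-1) * g)) ->
  forall g, S g.
Proof.
move=> S1 SM g; rewrite [g]presE; case: (repr g) => w rw.
have -> : FreeGroup rw = fg_of w by apply: val_inj; rewrite /= reduce_id.
elim: w {rw} => [|[y c] w IH]; first exact: S1.
have -> : fg_of ((y, c) :: w) = fg_of [:: (y, c)] * fg_of w.
  by apply: val_inj; rewrite /= (reduce_id (reduce_reduced w)).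
by rewrite gmulfM fg_of_letter; have := SM y c _ IH; case: c;
  rewrite //= gmulfV.
Qed.

End Presented.

(** * Relators under homomorphisms *)
Section Naturality.
Variables (G H : groupType) (f : UMagmaMorphism.type G H) (n : nat).
Implicit Types a b : G.

Lemma b_conj_morph a b r : f (b_conj a b r) = b_conj (f a) (f b) r.
Proof. by rewrite /b_conj !gmulfM gmulfV !gmulfXn. Qed.

Lemma tau_low_morph a b d j : f (tau_low a b d j) = tau_low (f a) (f b) d j.
Proof. by elim: d j => [|d IH] j /=; rewrite ?gmulfR ?IH b_conj_morph. Qed.

Lemma tau_last_morph a b i : f (tau_last n a b i) = tau_last n (f a) (f b) i.
Proof.
have E : f (tau_1n n a b) = tau_1n n (f a) (f b).
  by rewrite /tau_1n; case: odd; rewrite ?gmulfV b_conj_morph.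
by rewrite /tau_last; case: ifP => _; rewrite ?gmulfR ?tau_low_morph E.
Qed.

Lemma tau_morph a b i j : f (tau n a b i j) = tau n (f a) (f b) i j.
Proof.
rewrite /tau; case: ifP => _; first exact: tau_low_morph.
by case: ifP => _; rewrite ?gmulfR ?tau_low_morph tau_last_morph.
Qed.

Lemma sigma_morph a b i : f (sigma n a b i) = sigma n (f a) (f b) i.
Proof. by rewrite /sigma !gmulfM gmulfV !tau_morph. Qed.

Lemma W_morph u v : f (W u v) = W (f u) (f v).
Proof. by rewrite /W !gmulfM !gmulfV. Qed.

Lemma relators_morph a b : map f (relators n a b) = relators n (f a) (f b).
Proof.
rewrite /relators !map_cat /=; congr (_ ++ (_ ++ [:: _; _])).
- rewrite /relators1 map_allpairs; apply: eq_allpairs => // p q /=.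
  by rewrite gmulfR !tau_morph.
- rewrite /relators2 map_allpairs; apply: eq_allpairs => // p q /=.
  by rewrite gmulfM gmulfV gmulfR !tau_morph.
- by rewrite /relator3 gmulfXn sigma_morph.
rewrite /relator4 gmulfM gmulfV gmulf_prod; congr (_ * _^-1).
by apply: eq_bigr => i _; rewrite sigma_morph.
Qed.

Lemma uv_relators_morph u v : map f (uv_relators n u v) = uv_relators n (f u) (f
  v).
Proof.
rewrite /uv_relators map_rcons relators_morph W_morph; congr rcons.
by rewrite gmulfM gmulfV gmulfM gmulfV /= tau_morph !W_morph.
Qed.

End Naturality.

Section Relators.
Variables (G : groupType) (n : nat) (a b : G).
Hypothesis n0 : 0 < n.

Let x (i j : 'I_n) := tau n a b i.+1 j.+1.

Lemma idxP i : reflect (exists k : 'I_n, i = k.+1) (i \in idx n).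
Proof.
rewrite mem_iota; apply: (iffP andP) => [[i0 i_n]|[k ->]].
  have kn : (i.-1 < n)%N by lia.
  by exists (Ordinal kn); rewrite /=; lia.
by have := ltn_ord k; lia.
Qed.

Lemma idx_pairsP p :
  reflect (exists i j : 'I_n, i != j /\ p = (i.+1, j.+1)) (p \in idx_pairs n).
Proof.
apply: (iffP idP) => [|[i [j [ij ->]]]].
  rewrite mem_filter => /andP[ne /allpairsP[[i j] [/= /idxP[k ->] /idxP[l ->]
    pE]]].
  by exists k, l; split=> //; move: ne; rewrite pE /= eqSS val_eqE.
rewrite mem_filter /= eqSS val_eqE ij /=; apply: allpairs_f; apply/idxP;
  [by exists i | by exists j].
Qed.

(** Turns the list of relators into statements about the family tau_ij. *)
Lemma relators_trivialP :
  (forall r, r \in relators n a b -> r = 1) <->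
  [/\ steinberg x, sigma n a b 1 ^+ 4 = 1
    & a = \prod_(i <- rev (iota 1 n.-1)) sigma n a b i].
Proof.
split=> [R1|[st s4 aE] r].
  split.
  - split=> [i j k l ij kl il jk|i j k ij jk ik].
      have [E|ne] := eqVneq (i, j) (k, l); first by case: E => -> ->.
      apply/commgP/eqP/R1; rewrite mem_cat; apply/orP; left.
      apply: (@allpairs_f_dep _ _ _ _ _ _ (i.+1, j.+1) (k.+1, l.+1)).
        by apply/idx_pairsP; exists i, j.
          rewrite mem_filter xpair_eqE /= !eqSS !val_eqE il jk /= andbT.
      apply/andP; split.
        by move: ne; rewrite xpair_eqE.
      by apply/idx_pairsP; exists k, l.
    apply: divg1_eq; apply: R1; rewrite 2!mem_cat; apply/orP; right; apply/orP;
      left.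
    apply: (@allpairs_f_dep _ _ _ _ _ _ (i.+1, j.+1) k.+1).
      by apply/idx_pairsP; exists i, j.
    rewrite mem_filter /= !eqSS !val_eqE ![k == _]eq_sym ik jk /=.
    by apply/idxP; exists k.
  - by apply: R1; rewrite 2!mem_cat !inE eqxx !orbT.
  by apply: divg1_eq; apply: R1; rewrite 2!mem_cat !inE eqxx !orbT.
rewrite 2!mem_cat !inE => /or3P[||/orP[]/eqP->].
- case/allpairsPdep=> [P [Q [/idx_pairsP[i [j [ij ->]]] + ->]]].
  rewrite mem_filter => /andP[C /idx_pairsP[k [l [kl QE]]]]; move: C.
  rewrite {}QE /= !eqSS !val_eqE => /and3P[_ il jk]; apply/eqP/commgP.
  exact: st.1.
- case/allpairsPdep=> [P [Q [/idx_pairsP[i [j [ij ->]]] + ->]]].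
  rewrite mem_filter => /andP[C /idxP[k QE]]; move: C.
  rewrite {}QE /= !eqSS !val_eqE => /andP[ki kj].
  by rewrite [X in X / _](st.2 i j k) ?mulgV // eq_sym.
- exact: s4.
by rewrite /relator4 -aE mulgV.
Qed.

Lemma tau_21 : tau n a b 2 1 = b.
Proof. by rewrite /tau /= /b_conj /= expg0 invg1 mul1g mulg1. Qed.

End Relators.

(** * The isomorphism *)
Section Main.
Variable n : nat.
Hypothesis n3 : 3 <= n.

Let o : 'I_n := Ordinal (ltnW (ltnW n3)).
Let p : 'I_n := Ordinal (ltnW n3).
Let m : 'I_n := Ordinal (ltac:(by rewrite prednK // ltnW // ltnW) : n.-1 < n)%N.
Let mn : m.+1 = n. Proof. by rewrite /= prednK // ltnW // ltnW. Qed.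

Let R := uv_relators n fu fv.
Let u := pres_gen R true.
Let v := pres_gen R false.
Let b := W u v.
Let x (i j : 'I_n) := tau n u b i.+1 j.+1.
Definition uv_image (c : bool) : SLZ n := if c then u_ n else v_ n.

Lemma SL_relators r : r \in R -> fg_lift uv_image r = 1.
Proof.
move=> Rr; have : fg_lift uv_image r \in map (fg_lift uv_image) R
  by apply: map_f.
rewrite uv_relators_morph [_ fu](fg_lift_gen uv_image true) [_ fv](fg_lift_gen
  uv_image false).
rewrite /uv_image mem_rcons inE => /predU1P[->|].
  rewrite (@W_uv n n3 o p m erefl erefl mn) (@tau_T n n3 o p) //.
  rewrite (@v_T n o p) // (@b_T n p o) //.
  by rewrite mulgV.
apply: (relators_trivialP _ _ _).2; first by rewrite ltnW // ltnW.
rewrite (@W_uv n n3 o p m erefl erefl mn); split.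
- split=> [i j k l ij kl|i j k ij jk ik]; rewrite !tau_T //.
    exact: (@steinberg_elemSL n).1.
  exact: (@steinberg_elemSL n).2.
- by rewrite [sigma _ _ _ _](@sigma_T n n3 o p erefl) wt_elemSL_pow4.
exact: (@a_factorization n n3 o p m erefl erefl mn).
Qed.

Definition SL_iso : UMagmaMorphism.type (presented R) (SLZ n) :=
  pres_lift SL_relators.

Lemma SL_iso_gen c : SL_iso (pres_gen R c) = uv_image c.
Proof. by rewrite /SL_iso /= pres_liftE fg_lift_gen. Qed.

Lemma pres_relators r : r \in uv_relators n u v -> r = 1.
Proof.
by rewrite -(uv_relators_morph (pres_pi R)) => /mapP[s Rs ->];
  apply: pres_pi_relator.
Qed.

Lemma pres_steinberg : [/\ steinberg x, sigma n u b 1 ^+ 4 = 1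
    & u = \prod_(i <- rev (iota 1 n.-1)) sigma n u b i].
Proof.
apply/relators_trivialP; first by rewrite ltnW // ltnW.
by move=> r Rr; apply: pres_relators; rewrite mem_rcons inE Rr orbT.
Qed.

Lemma pres_v : v = b^-1 * tau n u b 1 2.
Proof. by apply: divg1_eq; apply: pres_relators;
  rewrite mem_rcons inE eqxx. Qed.

Lemma SL_iso_x i j : i != j -> SL_iso (x i j) = @elemSL n i j.
Proof.
move=> ij; rewrite /x tau_morph W_morph !SL_iso_gen /uv_image.
by rewrite (@W_uv n n3 o p m erefl erefl mn) tau_T.
Qed.

Lemma gen_x i j : i != j -> gen (elem_gens x n) (x i j).
Proof. by move=> ij; apply: gen_incl; exists i, j, false; split. Qed.

(** W(u, v) is tau_21; the last relator gives v and the factorization relator gives u. *)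
Lemma gen_all g : gen (elem_gens x n) g.
Proof.
have gb : gen (elem_gens x n) b.
  by rewrite -[b](tau_21 n u); apply: (@gen_x p o).
have gv : gen (elem_gens x n) v.
  by rewrite pres_v; apply: gen_mul (@gen_x o p _) => //; apply: elem_gens_inv.
have gu : gen (elem_gens x n) u.
  have [_ _ ->] := pres_steinberg; rewrite big_seq.
  apply: big_ind => [|y z|i]; [exact: gen_one | exact: gen_mul |].
  rewrite mem_rev mem_iota => /andP[i0 i_n].
  have [i1 i2] : (i.-1 < n)%N /\ (i < n)%N by lia.
  have e1 : i = (Ordinal i1).+1 by rewrite /= prednK.
  have ij : Ordinal i1 != Ordinal i2 by rewrite -val_eqE /=; lia.
  have ji : Ordinal i2 != Ordinal i1 by rewrite eq_sym.
  rewrite /sigma {1 4 5}e1; apply: gen_mul; first apply: gen_mul.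
  - exact: gen_x ij.
  - by apply: elem_gens_inv; apply: gen_x ji.
  exact: gen_x ij.
elim/pres_ind: g => [|c d g IH]; first exact: gen_one.
apply: gen_mul IH; have gc : gen (elem_gens x n) (pres_gen R c) by case: c.
by case: d => //; apply: elem_gens_inv.
Qed.

Lemma SL_iso_inj : injective SL_iso.
Proof.
apply: gmulf_inj => g; have [st s4 _] := pres_steinberg.
have w4 i j c : i != j -> weyl x i j c ^+ 4 = 1.
  apply: (wt_pow4 st (third n3) (_ : o != p)) => // -[]; last exact: s4.
  by rewrite -[true]/(~~ false) -wtV expVgn [_ ^+ 4]s4 invg1.
by apply: (steinberg_inj st n3 w4 SL_iso_x); apply: gen_all.
Qed.

Lemma SL_iso_surj A : exists g, SL_iso g == A.
Proof.
elim: (elementary_all A) => [|y B [i [j [c [ij _ _ ->]]]] _ [g /eqP gB]].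
  by exists 1; rewrite gmulf1.
exists (signed x i j c * g); rewrite gmulfM gB; apply/eqP; congr (_ * _).
exact: (phi_xs SL_iso_x).
Qed.

End Main.

Theorem theorem4p4 (n : nat) (hn : (3 <= n)%N) :
  [/\ has_order (u_ n) (if odd n then n else (2 * n)%N),
      has_order (v_ n) 6
    & exists phi : {multiplicative SL_presentation n -> SLZ n},
        [/\ bijective phi,
            phi (pres_gen (uv_relators n fu fv) true) = u_ n
          & phi (pres_gen (uv_relators n fu fv) false) = v_ n]].
Proof.
have mn : n.-1 < n by rewrite prednK // ltnW // ltnW.
split.
- by apply: (@order_u n hn (Ordinal (ltnW (ltnW hn))) (Ordinal (ltnW hn))
    (Ordinal mn)) => //=; lia.
- by apply: (@order_v n hn (Ordinal (ltnW (ltnW hn))) (Ordinal (ltnW hn))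
    (Ordinal mn)) => //=; lia.
exists (SL_iso hn); split; try exact: SL_iso_gen.
exists (fun A => xchoose (SL_iso_surj hn A)) => [g|A].
  apply: (@SL_iso_inj n hn); apply/eqP.
  exact: (xchooseP (SL_iso_surj hn (SL_iso hn g))).
apply/eqP; exact: (xchooseP (SL_iso_surj hn A)).
Qed.
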